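(* The sphere $S^6$, viewed as the homogeneous space $G_2/SU(3)$, admits exactly one $G_2$-invariant almost Hermitian structure up to homothety. This structure is nearly Kähler and $3$-symmetric.
   Context: An almost Hermitian structure $(g,J)$ is a Riemannian metric and an almost complex structure with $g(JX,JY)=g(X,Y)$. It is nearly Kähler if $(\nabla_XJ)Y=-(\nabla_YJ)X$ for all $X,Y$ ($\nabla$ the Levi-Civita connection). Uniqueness up to homothety means that for any two invariant structures $(g,J)$, $(g',J')$ there are a diffeomorphism $\varphi$ of $S^6$ and a constant $c>0$ with $\varphi^*g'=c\,g$ and $\varphi^*J'=J$. A $3$-symmetric space is a Riemannian manifold $M$ with a family of global isometries $\theta_m$, $m\in M$, such that $\theta_m^3=\mathrm{Id}$ and $m$ is an isolated fixed point of $\theta_m$; its canonical almost complex structure is given by $(\theta_m)_*=-\frac12\mathrm{Id}_{T_mM}+\frac{\sqrt3}2J_m$. *)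

(* Defs.v *)
From mathcomp Require Import all_boot all_order all_algebra.
From mathcomp Require Import all_classical all_reals all_analysis.
From mathcomp Require Import complex.
Set Implicit Arguments.
Unset Strict Implicit.
Unset Printing Implicit Defensive.
Import Order.TTheory GRing.Theory Num.Theory.
Import numFieldNormedType.Exports.
Local Open Scope classical_set_scope.
Local Open Scope ring_scope.

(* S^6 is the unit sphere of R^7 = 'cV[R]_7.  Maps and tensor fields on S^6 are
   total functions on 'cV[R]_7 of which only the values at points of S^6 and at
   tangent vectors matter; everything below is insensitive to other values. *)

Section Smoothness.
Variables (R : realType) (V W : normedModType R).

Fixpoint Ck (k : nat) (U : set V) (f : V -> W) : Prop :=
  if k is k'.+1 then
    (forall x, U x -> differentiable f x) /\
    (forall v : V, Ck k' U (fun x => 'D_v f x))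
  else forall x, U x -> {for x, continuous f}.

Definition smooth_on (U : set V) (f : V -> W) : Prop := forall k, Ck k U f.

End Smoothness.

Section Sphere.
Variable R : realType.
Local Notation vec := 'cV[R]_7.

(* The norm that the library puts on matrices is the sup norm, whence an
   explicit Euclidean inner product. *)
Definition dot (u v : vec) : R := \sum_i u i 0 * v i 0.

Definition S6 : set vec := [set x | dot x x = 1].

Definition tangent (x v : vec) : Prop := dot x v = 0.

(* Smoothness on an embedded submanifold: local smooth extensions exist. *)
Definition smoothS (W : normedModType R) (f : vec -> W) : Prop :=
  forall p, S6 p -> exists (U : set vec) (F : vec -> W),
    [/\ open U, U p, smooth_on U F & forall x, U x -> S6 x -> F x = f x].

Definition normalize (x : vec) : vec := (Num.sqrt (dot x x))^-1 *: x.

(* The differential at p \in S^6, on v tangent at p, of a map smooth on S^6: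
   x |-> f (x / |x|) is an extension of f that uses only its values on S^6. *)
Definition dS (W : normedModType R) (f : vec -> W) (p v : vec) : W :=
  'D_v (f \o normalize) p.

Record vector_field (X : vec -> vec) : Prop := VectorField {
  vf_tangent : forall p, S6 p -> tangent p (X p);
  vf_smooth : smoothS X }.

Record diffeo (phi psi : vec -> vec) : Prop := Diffeo {
  diffeo_maps : forall p, S6 p -> S6 (phi p);
  diffeo_inv_maps : forall p, S6 p -> S6 (psi p);
  diffeo_smooth : smoothS phi;
  diffeo_inv_smooth : smoothS psi;
  diffeoK : forall p, S6 p -> psi (phi p) = p;
  diffeo_invK : forall p, S6 p -> phi (psi p) = p }.

Definition metric_field := vec -> vec -> vec -> R.
Definition endo_field := vec -> vec -> vec.

Record riemannian (g : metric_field) : Prop := Riemannian {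
  riem_linear : forall p (a : R) u v w, S6 p ->
    tangent p u -> tangent p v -> tangent p w ->
    g p (a *: u + v) w = a * g p u w + g p v w;
  riem_sym : forall p u v, S6 p -> tangent p u -> tangent p v ->
    g p u v = g p v u;
  riem_pos : forall p u, S6 p -> tangent p u -> u != 0 -> 0 < g p u u;
  riem_smooth : forall X Y, vector_field X -> vector_field Y ->
    @smoothS R^o (fun p => g p (X p) (Y p)) }.

Record almost_complex (J : endo_field) : Prop := AlmostComplex {
  acs_tangent : forall p u, S6 p -> tangent p u -> tangent p (J p u);
  acs_linear : forall p (a : R) u v, S6 p -> tangent p u -> tangent p v ->
    J p (a *: u + v) = a *: J p u + J p v;
  acs_sqr : forall p u, S6 p -> tangent p u -> J p (J p u) = - u;
  acs_smooth : forall X, vector_field X -> smoothS (fun p => J p (X p)) }.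

Record almost_hermitian (g : metric_field) (J : endo_field) : Prop :=
  AlmostHermitian {
  ah_metric : riemannian g;
  ah_complex : almost_complex J;
  ah_compat : forall p u v, S6 p -> tangent p u -> tangent p v ->
    g p (J p u) (J p v) = g p u v }.

Definition pullback_metric (phi : vec -> vec) (g : metric_field) : metric_field :=
  fun p u v => g (phi p) (dS phi p u) (dS phi p v).

(* psi is the inverse of phi. *)
Definition pullback_endo (phi psi : vec -> vec) (J : endo_field) : endo_field :=
  fun p u => dS psi (phi p) (J (phi p) (dS phi p u)).

Definition homothetic (g : metric_field) (J : endo_field)
    (g' : metric_field) (J' : endo_field) : Prop :=
  exists (phi psi : vec -> vec) (c : R),
    [/\ diffeo phi psi, 0 < c,
        forall p u v, S6 p -> tangent p u -> tangent p v ->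
          pullback_metric phi g' p u v = c * g p u v
      & forall p u, S6 p -> tangent p u -> pullback_endo phi psi J' p u = J p u].

Definition isometry (g : metric_field) (phi : vec -> vec) : Prop :=
  (exists psi, diffeo phi psi) /\
  forall p u v, S6 p -> tangent p u -> tangent p v ->
    pullback_metric phi g p u v = g p u v.

(* Lie bracket of vector fields on a submanifold of R^7: D_X Y - D_Y X. *)
Definition lie_bracket (X Y : vec -> vec) : vec -> vec :=
  fun p => dS Y p (X p) - dS X p (Y p).

Record levi_civita (g : metric_field)
    (nabla : (vec -> vec) -> (vec -> vec) -> (vec -> vec)) : Prop := LeviCivita {
  lc_field : forall X Y, vector_field X -> vector_field Y ->
    vector_field (nabla X Y);
  lc_linearl : forall (f : vec -> R^o) X X' Y p, smoothS f ->
    vector_field X -> vector_field X' -> vector_field Y -> S6 p ->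
    nabla (fun q => f q *: X q + X' q) Y p = f p *: nabla X Y p + nabla X' Y p;
  lc_additiver : forall X Y Y' p,
    vector_field X -> vector_field Y -> vector_field Y' -> S6 p ->
    nabla X (fun q => Y q + Y' q) p = nabla X Y p + nabla X Y' p;
  lc_leibniz : forall (f : vec -> R^o) X Y p, smoothS f ->
    vector_field X -> vector_field Y -> S6 p ->
    nabla X (fun q => f q *: Y q) p = dS f p (X p) *: Y p + f p *: nabla X Y p;
  lc_torsion_free : forall X Y p, vector_field X -> vector_field Y -> S6 p ->
    nabla X Y p - nabla Y X p = lie_bracket X Y p;
  lc_metric : forall X Y Z p,
    vector_field X -> vector_field Y -> vector_field Z -> S6 p ->
    @dS R^o (fun q => g q (Y q) (Z q)) p (X p) =
      g p (nabla X Y p) (Z p) + g p (Y p) (nabla X Z p) }.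

(* (nabla_X J) Y *)
Definition cov_deriv_endo (nabla : (vec -> vec) -> (vec -> vec) -> (vec -> vec))
    (J : endo_field) (X Y : vec -> vec) : vec -> vec :=
  fun p => nabla X (fun q => J q (Y q)) p - J p (nabla X Y p).

(* By the fundamental theorem of Riemannian geometry, nabla is unique on S^6. *)
Definition nearly_kahler (g : metric_field) (J : endo_field) : Prop :=
  almost_hermitian g J /\
  exists nabla, levi_civita g nabla /\
    forall X Y p, vector_field X -> vector_field Y -> S6 p ->
      cov_deriv_endo nabla J X Y p = - cov_deriv_endo nabla J Y X p.

Definition isolated_fixed_point (phi : vec -> vec) (m : vec) : Prop :=
  phi m = m /\
  exists U : set vec, [/\ open U, U m &
    forall x, U x -> S6 x -> phi x = x -> x = m].

(* g is 3-symmetric and J is its canonical almost complex structure. *)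
Definition three_symmetric (g : metric_field) (J : endo_field) : Prop :=
  riemannian g /\
  exists theta : vec -> vec -> vec, forall m, S6 m ->
    [/\ isometry g (theta m),
        forall x, S6 x -> theta m (theta m (theta m x)) = x,
        isolated_fixed_point (theta m) m
      & forall v, tangent m v ->
          dS (theta m) m v = - 2^-1 *: v + (Num.sqrt 3 / 2) *: J m v].

(* Octonions are R + Im O with Im O = R^7.  Indices are read modulo 7 and the
   imaginary units satisfy e_i e_(i+1) = e_(i+3), cyclically on each triple
   {i, i+1, i+3}; cross u v is the imaginary part of u v. *)
Definition cross (u v : vec) : vec :=
  \col_(k < 7)
    ((u (k + 1) 0 * v (k + 3) 0 - u (k + 3) 0 * v (k + 1) 0)
   + (u (k + 2) 0 * v (k + 6) 0 - u (k + 6) 0 * v (k + 2) 0)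
   + (u (k + 4) 0 * v (k + 5) 0 - u (k + 5) 0 * v (k + 4) 0)).

Definition octonion : Type := (R * vec)%type.

Definition omul (x y : octonion) : octonion :=
  (x.1 * y.1 - dot x.2 y.2, x.1 *: y.2 + y.1 *: x.2 + cross x.2 y.2).

(* G_2 = Aut(O): every automorphism of the real algebra O fixes 1 and preserves
   Im O, hence is (a, u) |-> (a, A u) for some A \in GL(7, R). *)
Definition G2 : set 'M[R]_7 :=
  [set A | A \in unitmx /\
    forall x y : octonion,
      omul (x.1, A *m x.2) (y.1, A *m y.2) =
      ((omul x y).1, A *m (omul x y).2)].

Definition SU3 : set 'M[R[i]]_3 := [set U | U \is unitarymx /\ \det U = 1].

Definition base_point : vec := delta_mx 0 0.

(* Complex coordinates on the tangent space at e_0, whose complex structure is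
   left multiplication by e_0: e_0 e_1 = e_3, e_0 e_2 = e_6, e_0 e_4 = e_5. *)
Definition complex_coords (x : vec) : 'cV[R[i]]_3 :=
  \col_(j < 3) nth 0 [:: (x 1 0 +i* x 3 0)%C; (x 2 0 +i* x 6 0)%C;
                         (x 4 0 +i* x 5 0)%C] j.

(* S^6 = G_2 / SU(3): G_2 acts on S^6, transitively, and the isotropy group of
   e_0 is SU(3) acting on R e_0 + C^3 by (t, z) |-> (t, U z). *)
Definition S6_is_G2_mod_SU3 : Prop :=
  [/\ forall A x, G2 A -> S6 x -> S6 (A *m x),
      forall x y, S6 x -> S6 y -> exists2 A, G2 A & A *m x = y
    & forall A : 'M[R]_7,
        (G2 A /\ A *m base_point = base_point) <->
        exists2 U, SU3 U &
          forall x : vec, (A *m x) 0 0 = x 0 0 /\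
            complex_coords (A *m x) = U *m complex_coords x].

Record G2_invariant (g : metric_field) (J : endo_field) : Prop := G2Invariant {
  inv_metric : forall A p u v, G2 A -> S6 p -> tangent p u -> tangent p v ->
    g (A *m p) (A *m u) (A *m v) = g p u v;
  inv_complex : forall A p u, G2 A -> S6 p -> tangent p u ->
    J (A *m p) (A *m u) = A *m J p u }.

Definition invariant_structure (g : metric_field) (J : endo_field) : Prop :=
  almost_hermitian g J /\ G2_invariant g J.

End Sphere.

(* Main.v *)
(* G_2 is the group of matrices preserving the inner product and the cross
   product of R^7.  Two orthonormal vectors x, a, completed by a unit vector c
   orthogonal to x, a and x*a, generate an orthonormal basis with the
   multiplication table of e_0, ..., e_6; hence G_2 is transitive on orthonormal
   pairs.  This forces an invariant metric to be c times the round one.  The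
   element of G_2 with e_0, e_1, e_2 |-> e_0, e_1, -e_2 forces J_x a to lie in
   the span of a and x*a, and J^2 = -1 leaves only J_x a = x*a or -x*a.
   The antipodal map exchanges the two signs.  Conversely these structures are
   nearly Kaehler because the derivative of J at x along X applied to Y is the
   tangential part of X*Y up to sign, and 3-symmetric by the linear rotations
   of R^7 fixing m and equal to -1/2 + (sqrt 3 / 2) J_m on its orthogonal
   complement.  In complex coordinates on the orthogonal complement of e_0 the
   inner product and the e_0-component of the cross product form the Hermitian
   product, and the rest of the cross product is the complex volume form, whence
   the isotropy group SU(3). *)
From HB Require Import structures.
Require Import Defs.
From mathcomp Require Import all_boot all_order all_algebra.
From mathcomp Require Import all_classical all_reals all_analysis.
From mathcomp Require Import complex.
From mathcomp Require Import ring lra.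
Set Implicit Arguments.
Unset Strict Implicit.
Unset Printing Implicit Defensive.
Import Order.TTheory GRing.Theory Num.Theory.
Import numFieldNormedType.Exports.
Local Open Scope classical_set_scope.
Local Open Scope ring_scope.

(** The numerals are elements of the ring Z/7; the ordinals produced by a case analysis are matched
    with them through their values, whence [val_inj]. *)
Lemma forall_ord7 (P : 'I_7 -> Prop) :
  P 0 -> P 1 -> P 2 -> P 3 -> P 4 -> P 5 -> P 6 -> forall i, P i.
Proof.
move=> P0 P1 P2 P3 P4 P5 P6 i.
have Pi j : P j -> i = j :> nat -> P i by move=> Pj /val_inj ->.
case: i Pi => [[|[|[|[|[|[|[|//]]]]]]] lti] Pi;
  [exact: Pi P0 _|exact: Pi P1 _|exact: Pi P2 _|exact: Pi P3 _|exact: Pi P4 _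
  |exact: Pi P5 _|exact: Pi P6 _].
Qed.

(** * The cross product of R^7 *)

Section CrossProduct.
Variable R : realType.
Local Notation vec := 'cV[R]_7.
Implicit Types (u v w x a c : vec) (A : 'M[R]_7) (k : R).

Lemma dotE u v : dot u v = u 0 0 * v 0 0 + u 1 0 * v 1 0 + u 2 0 * v 2 0
  + u 3 0 * v 3 0 + u 4 0 * v 4 0 + u 5 0 * v 5 0 + u 6 0 * v 6 0.
Proof.
rewrite /dot !big_ord_recr big_ord0 /= add0r.
by congr (u _ 0 * v _ 0 + u _ 0 * v _ 0 + u _ 0 * v _ 0
  + u _ 0 * v _ 0 + u _ 0 * v _ 0 + u _ 0 * v _ 0 + u _ 0 * v _ 0); apply: val_inj.
Qed.

(** The equations are packed as a product so that one [rewrite] selects the coordinate at hand, with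
    the indices already reduced modulo 7. *)
Lemma crossE u v :
  ((cross u v 0 0 = ((u 1 0 * v 3 0 - u 3 0 * v 1 0)
     + (u 2 0 * v 6 0 - u 6 0 * v 2 0) + (u 4 0 * v 5 0 - u 5 0 * v 4 0))%R)
  * (cross u v 1 0 = ((u 2 0 * v 4 0 - u 4 0 * v 2 0)
     + (u 3 0 * v 0 0 - u 0 0 * v 3 0) + (u 5 0 * v 6 0 - u 6 0 * v 5 0))%R)
  * (cross u v 2 0 = ((u 3 0 * v 5 0 - u 5 0 * v 3 0)
     + (u 4 0 * v 1 0 - u 1 0 * v 4 0) + (u 6 0 * v 0 0 - u 0 0 * v 6 0))%R)
  * (cross u v 3 0 = ((u 4 0 * v 6 0 - u 6 0 * v 4 0)
     + (u 5 0 * v 2 0 - u 2 0 * v 5 0) + (u 0 0 * v 1 0 - u 1 0 * v 0 0))%R)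
  * (cross u v 4 0 = ((u 5 0 * v 0 0 - u 0 0 * v 5 0)
     + (u 6 0 * v 3 0 - u 3 0 * v 6 0) + (u 1 0 * v 2 0 - u 2 0 * v 1 0))%R)
  * (cross u v 5 0 = ((u 6 0 * v 1 0 - u 1 0 * v 6 0)
     + (u 0 0 * v 4 0 - u 4 0 * v 0 0) + (u 2 0 * v 3 0 - u 3 0 * v 2 0))%R)
  * (cross u v 6 0 = ((u 0 0 * v 2 0 - u 2 0 * v 0 0)
     + (u 1 0 * v 5 0 - u 5 0 * v 1 0) + (u 3 0 * v 4 0 - u 4 0 * v 3 0))%R)
)%type.
Proof.
by do !split; rewrite mxE;
  congr ((u _ 0 * v _ 0 - u _ 0 * v _ 0) + (u _ 0 * v _ 0 - u _ 0 * v _ 0)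
  + (u _ 0 * v _ 0 - u _ 0 * v _ 0)); apply: val_inj.
Qed.

Ltac gen_coords u :=
  move: (u 0 0) (u 1 0) (u 2 0) (u 3 0) (u 4 0) (u 5 0) (u 6 0).

Lemma col7P u v : (forall i, u i 0 = v i 0) -> u = v.
Proof. by move=> uv; apply/matrixP => i j; rewrite ord1. Qed.

Lemma dotC u v : dot u v = dot v u.
Proof. by apply: eq_bigr => i _; rewrite mulrC. Qed.

Lemma dotDl u v w : dot (u + v) w = dot u w + dot v w.
Proof. by rewrite -big_split; apply: eq_bigr => i _; rewrite mxE mulrDl. Qed.

Lemma dotZl k u v : dot (k *: u) v = k * dot u v.
Proof. by rewrite mulr_sumr; apply: eq_bigr => i _; rewrite mxE mulrA. Qed.

Lemma dotDr u v w : dot u (v + w) = dot u v + dot u w.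
Proof. by rewrite dotC dotDl !(dotC _ u). Qed.

Lemma dotZr k u v : dot u (k *: v) = k * dot u v.
Proof. by rewrite dotC dotZl dotC. Qed.

Lemma dotNl u v : dot (- u) v = - dot u v.
Proof. by rewrite -scaleN1r dotZl mulN1r. Qed.

Lemma dotNr u v : dot u (- v) = - dot u v.
Proof. by rewrite dotC dotNl dotC. Qed.

Lemma dot0l u : dot 0 u = 0.
Proof. by rewrite -(scale0r 0) dotZl mul0r. Qed.

Lemma dot0r u : dot u 0 = 0.
Proof. by rewrite dotC dot0l. Qed.

Lemma dot_ge0 u : 0 <= dot u u.
Proof. by apply: sumr_ge0 => i _; rewrite -expr2 sqr_ge0. Qed.

Lemma dot_eq0 u : dot u u = 0 -> u = 0.
Proof.
move=> /eqP; rewrite psumr_eq0 => [/allP u0|i _]; last by rewrite -expr2 sqr_ge0.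
apply: col7P => i; rewrite mxE; apply/eqP.
by have := u0 i (mem_index_enum _); rewrite mulf_eq0 orbb.
Qed.

Lemma dot_gt0 u : u != 0 -> 0 < dot u u.
Proof.
move=> u0; rewrite lt_neqAle dot_ge0 andbT eq_sym.
by apply: contra_neq u0 => /dot_eq0.
Qed.

Lemma dot_inj u v : (forall w, dot u w = dot v w) -> u = v.
Proof.
move=> uv; apply/subr0_eq/dot_eq0.
by rewrite {1}dotDl dotNl uv subrr.
Qed.

Lemma dot_mx u v : dot u v = (u^T *m v) 0 0.
Proof. by rewrite mxE; apply: eq_bigr => i _; rewrite mxE. Qed.

Lemma dot_mull A u v : dot (A *m u) v = dot u (A^T *m v).
Proof. by rewrite !dot_mx trmx_mul mulmxA. Qed.

Lemma crossC u v : cross u v = - cross v u.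
Proof. by apply: col7P => i; rewrite !mxE; ring. Qed.

Lemma crossDr u v w : cross u (v + w) = cross u v + cross u w.
Proof. by apply: col7P => i; rewrite !mxE; ring. Qed.

Lemma crossZr k u v : cross u (k *: v) = k *: cross u v.
Proof. by apply: col7P => i; rewrite !mxE; ring. Qed.

Lemma crossDl u v w : cross (u + v) w = cross u w + cross v w.
Proof. by rewrite crossC crossDr opprD -!crossC. Qed.

Lemma crossZl k u v : cross (k *: u) v = k *: cross u v.
Proof. by rewrite crossC crossZr -scalerN -crossC. Qed.

Lemma crossNr u v : cross u (- v) = - cross u v.
Proof. by rewrite -scaleN1r crossZr scaleN1r. Qed.

Lemma cross0l u : cross 0 u = 0.
Proof. by have := crossZl 0 0 u; rewrite !scale0r. Qed.

Lemma cross0r u : cross u 0 = 0.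
Proof. by rewrite crossC cross0l oppr0. Qed.

Lemma crossvv u : cross u u = 0.
Proof. by apply: col7P => i; rewrite !mxE; ring. Qed.

Lemma dot_cross u v w : dot (cross u v) w = dot u (cross v w).
Proof. rewrite !dotE !crossE; gen_coords u; gen_coords v; gen_coords w => *; ring. Qed.

(* Alternativity of the octonions, polarised. *)
Lemma cross_cross u v w : cross u (cross v w) =
  dot u w *: v + dot v w *: u - (2 * dot u v) *: w - cross v (cross u w).
Proof.
apply: col7P; apply: forall_ord7; rewrite !dotE !(crossE, mxE);
  gen_coords u; gen_coords v; gen_coords w => *; ring.
Qed.

(** With equal left factors the polarised identity carries the double product on both sides, so it
    gives twice the claim. *)
Lemma cross_crossvv u w : cross u (cross u w) = dot u w *: u - dot u u *: w.
Proof.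
apply: (@scalerI _ _ 2); rewrite ?pnatr_eq0 // scaler_nat mulr2n {1}cross_cross.
by rewrite subrK scalerBr !scalerA [2 * dot u w]mulr_natl mulr2n scalerDl.
Qed.

Lemma cross_orthoC u v w : dot u v = 0 -> dot u w = 0 -> dot v w = 0 ->
  cross u (cross v w) = - cross v (cross u w).
Proof.
by move=> uv uw vw; rewrite cross_cross uv uw vw mulr0 !scale0r !(addr0, subr0, sub0r).
Qed.

Lemma cross_unitK u w : dot u u = 1 -> dot u w = 0 -> cross u (cross u w) = - w.
Proof. by move=> u1 uw; rewrite cross_crossvv u1 uw scale0r scale1r add0r. Qed.

Lemma dot_crossl u v : dot u (cross u v) = 0.
Proof. by rewrite -dot_cross crossvv dot0l. Qed.

Lemma dot_crossr u v : dot u (cross v u) = 0.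
Proof. by rewrite crossC dotNr dot_crossl oppr0. Qed.

Lemma dot_cross_cross u v w :
  dot (cross u v) (cross u w) = dot u u * dot v w - dot u v * dot u w.
Proof.
rewrite crossC dotNl dot_cross cross_crossvv dotDr dotNr !dotZr (dotC v u).
by rewrite opprB; congr (_ - _); rewrite mulrC.
Qed.

End CrossProduct.

(** * Frames with the octonion multiplication table *)

Section Frames.
Variable R : realType.
Local Notation vec := 'cV[R]_7.
Implicit Types (u v w x a c : vec) (A : 'M[R]_7) (b : 'I_7 -> vec).

Lemma mulmx_ext m n (A B : 'M[R]_(m, n)) :
  (forall u : 'cV_n, A *m u = B *m u) -> A = B.
Proof.
move=> AB; apply/matrixP => i j.
by have := AB (delta_mx j 0); rewrite -!colE => /matrixP/(_ i 0); rewrite !mxE.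
Qed.

(** The product of two imaginary octonions has real part [- dot] and imaginary part [cross], which
    gives the direct implication. Conversely, preservation of [dot] means A^T A = 1, and this
    supplies invertibility. *)
Lemma G2P A : G2 A <->
  (forall u v, dot (A *m u) (A *m v) = dot u v) /\
  (forall u v, cross (A *m u) (A *m v) = A *m cross u v).
Proof.
split=> [[_ AG]|[Ad Ac]].
  have {}AG u v : omul (0, A *m u) (0, A *m v) =
      ((omul (0, u) (0, v)).1, A *m (omul (0, u) (0, v)).2) := AG (0, u) (0, v).
  split=> u v; have [] := AG u v; rewrite /= !mul0r !sub0r !scale0r !add0r //.
  by move=> /oppr_inj.
split=> [|x y]; last by rewrite /omul /= Ad Ac !mulmxDr !scalemxAr.
suff /mulmx1_unit[] : A^T *m A = 1%:M by [].
apply: mulmx_ext => u; apply: dot_inj => w.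
by rewrite -mulmxA dotC -dot_mull Ad mul1mx dotC.
Qed.

Definition orthonormal_frame b := forall i j, dot (b i) (b j) = (i == j)%:R.

Record G2_frame b : Prop := G2Frame {
  frame_dot : orthonormal_frame b;
  frame_cross : forall i, cross (b i) (b (i + 1)) = b (i + 3) }.

Definition std_frame (i : 'I_7) : vec := delta_mx i 0.

Definition frame_mx b : 'M[R]_7 := \matrix_(i, j) b j i 0.

Lemma frame_mxE b u : frame_mx b *m u = \sum_j u j 0 *: b j.
Proof.
apply: col7P => i; rewrite mxE summxE.
by apply: eq_bigr => j _; rewrite !mxE mulrC.
Qed.

Lemma frame_mx_std b i : frame_mx b *m std_frame i = b i.
Proof. by rewrite -colE; apply: col7P => j; rewrite !mxE. Qed.

Lemma std_frame_sum u : u = \sum_j u j 0 *: std_frame j.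
Proof.
rewrite -frame_mxE -[LHS]mul1mx; congr (_ *m _).
by apply/matrixP => i j; rewrite !mxE eqxx andbT.
Qed.

Lemma std_G2_frame : G2_frame std_frame.
Proof.
split=> [i j|i].
  rewrite /dot (bigD1 i) //= big1 => [|k /negPf ki]; last by rewrite !mxE ki mul0r.
  by rewrite !mxE !eqxx mul1r addr0 andbT.
apply: col7P; elim/forall_ord7: i; apply: forall_ord7;
  rewrite crossE !mxE /= ?(mul0r, mulr0, mul1r, subrr, addr0, add0r, sub0r, oppr0, subr0) //.
Qed.

(* The multiplication table, read off from e_i e_(i+1) = e_(i+3) alone. *)
Lemma frame_table (d : 'I_7) : exists (s : R) (t : 'I_7),
  forall b, G2_frame b -> forall i, cross (b i) (b (i + d)) = s *: b (i + t).
Proof.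
have E (k l : 'I_7) : k = l :> nat -> k = l by move/val_inj.
(* The starting index [i] is arbitrary, so the relation is stable under a common translation of the
   three offsets ([shift]), and exchanging the factors costs a sign ([neg]). *)
pose S (k l m : 'I_7) := forall b, G2_frame b -> forall i : 'I_7,
  cross (b (i + k)) (b (i + l)) = b (i + m).
have S1 : S 0 1 3 by move=> b [_ bc] i; rewrite addr0 bc.
have bo b : G2_frame b -> forall i k l : 'I_7,
    dot (b (i + k)) (b (i + l)) = (k == l)%:R.
  by move=> [bo _] i k l; rewrite bo (inj_eq (addrI i)).
have S2 : S 1 3 0.
  move=> b bG i; have := bo b bG i => {}bo.
  by rewrite -S1 // (crossC (b (i + 0))) crossNr cross_unitK ?opprK // bo.
have S3 : S 3 0 1.
  move=> b bG i; have := bo b bG i => {}bo.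
  by rewrite -S1 // crossC cross_unitK ?opprK // bo.
have shift (r k l m k' l' m' : 'I_7) : S k l m -> k + r = k' :> nat ->
    l + r = l' :> nat -> m + r = m' :> nat -> S k' l' m'.
  move=> Sklm /E <- /E <- /E <- b bG i.
  by rewrite ![_ + r]addrC !addrA Sklm.
have pos k l m b i : S k l m -> G2_frame b ->
    cross (b (i + k)) (b (i + l)) = 1 *: b (i + m).
  by move=> Sklm bG; rewrite Sklm ?scale1r.
have neg k l m b i : S k l m -> G2_frame b ->
    cross (b (i + l)) (b (i + k)) = -1 *: b (i + m).
  by move=> Sklm bG; rewrite crossC Sklm ?scaleN1r.
have base s t : (forall b, G2_frame b -> forall i,
      cross (b (i + 0)) (b (i + d)) = s *: b (i + t)) ->
    exists (s : R) (t : 'I_7), forall b, G2_frame b -> forall i, cross (b i) (b (i + d)) = s *: b (i + t).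
  by move=> H; exists s, t => b bG i; rewrite -H // addr0.
elim/forall_ord7: d base => base.
(* The differences along the cyclic triple (0, 1, 3) are 1, 2 and 4, the nonzero squares modulo 7,
   and get the sign +1; their opposites 6, 5 and 3 get -1. A translation then brings the first
   offset to 0. *)
- by apply: (base 0 0) => b bG i; rewrite crossvv scale0r.
- by apply: (base 1 3) => b bG i; apply: pos.
- by apply: (base 1 6) => b bG i; apply: pos => //; apply: (shift 6) S2 _ _ _.
- by apply: (base (-1) 1) => b bG i; apply: neg.
- by apply: (base 1 5) => b bG i; apply: pos => //; apply: (shift 4) S3 _ _ _.
- by apply: (base (-1) 4) => b bG i; apply: neg => //; apply: (shift 4) S2 _ _ _.
- by apply: (base (-1) 2) => b bG i; apply: neg => //; apply: (shift 6) S1 _ _ _.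
Qed.

(** By bilinearity it is enough to compare pairs of standard vectors. The sign and the offset given
    by [frame_table] do not depend on the frame, so they serve both for [b] and for the standard
    frame. *)
Lemma cross_frame_mx b u v :
  G2_frame b -> cross (frame_mx b *m u) (frame_mx b *m v) = frame_mx b *m cross u v.
Proof.
move=> bG.
have bilin (f : vec -> vec -> vec) :
    (forall k u v w, f (k *: u + v) w = k *: f u w + f v w) ->
    (forall k u v w, f w (k *: u + v) = k *: f w u + f w v) ->
    (forall i j, f (std_frame i) (std_frame j) = 0) -> forall u v, f u v = 0.
  move=> fl fr f0.
  have f0l w : f 0 w = 0 by have := fl (-1) 0 0 w; rewrite scaler0 addr0 scaleN1r addNr.
  have f0r w : f w 0 = 0 by have := fr (-1) 0 0 w; rewrite scaler0 addr0 scaleN1r addNr.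
  move=> {}u {}v; rewrite (std_frame_sum u).
  elim/big_rec: _ => // i x _ fx; rewrite fl fx addr0 (std_frame_sum v).
  apply/eqP; rewrite scaler_eq0; apply/orP; right; apply/eqP.
  by elim/big_rec: _ => // j y _ fy; rewrite fr fy f0 scaler0 addr0.
apply/eqP; rewrite -subr_eq0; apply/eqP.
apply: (bilin (fun u v =>
  cross (frame_mx b *m u) (frame_mx b *m v) - frame_mx b *m cross u v)).
- move=> k x y w; rewrite mulmxDr -scalemxAr crossDl crossZl crossDl crossZl mulmxDr -scalemxAr.
  by rewrite scalerBr opprD addrACA.
- move=> k x y w; rewrite mulmxDr -scalemxAr crossDr crossZr crossDr crossZr mulmxDr -scalemxAr.
  by rewrite scalerBr opprD addrACA.
move=> i j; rewrite !frame_mx_std -(subrK i j) (addrC _ i).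
have [s [t T]] := frame_table (j - i).
rewrite !T //; last exact: std_G2_frame.
by rewrite -scalemxAr frame_mx_std subrr.
Qed.

Lemma dot_frame_mx b u v :
  orthonormal_frame b -> dot (frame_mx b *m u) (frame_mx b *m v) = dot u v.
Proof.
move=> bo; rewrite dot_mull mulmxA.
suff -> : (frame_mx b)^T *m frame_mx b = 1%:M by rewrite mul1mx.
apply/matrixP => i j; rewrite [RHS]mxE -bo mxE.
by apply: eq_bigr => k _; rewrite !mxE.
Qed.

Lemma G2_frame_mx b : G2_frame b -> G2 (frame_mx b).
Proof.
move=> bG; apply/G2P; split=> u v; last exact: cross_frame_mx.
by apply: dot_frame_mx; case: bG.
Qed.

(** The order is dictated by e_0 e_1 = e_3, e_1 e_2 = e_4, e_0 e_4 = e_5 and e_0 e_2 = e_6. *)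
Definition triple_frame x a c (i : 'I_7) : vec :=
  nth 0 [:: x; a; c; cross x a; cross a c; cross x (cross a c); cross x c] i.

(** Two rules yield the products: left multiplications by orthogonal u and v anticommute on vectors
    orthogonal to both, and that by a unit vector squares to -1 on its orthogonal complement. The
    inner products follow by moving factors through the alternating form [dot (cross u v) w]. *)
Lemma triple_G2_frame x a c : dot x x = 1 -> dot a a = 1 -> dot c c = 1 ->
  dot x a = 0 -> dot x c = 0 -> dot a c = 0 -> dot (cross x a) c = 0 ->
  G2_frame (triple_frame x a c).
Proof.
move=> x1 a1 c1 xa xc ac xac.
set b := triple_frame x a c; pose p := cross a c.
have xp : dot x p = 0 by rewrite -dot_cross.
have pp : dot p p = 1 by rewrite dot_cross_cross a1 c1 ac !mul0r subr0 mulr1.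
have ap : dot a p = 0 by rewrite dot_crossl.
have cp : dot c p = 0 by rewrite dot_crossr.
have cxp : dot (cross c x) p = 0.
  by rewrite /p (crossC a) dotNr dot_cross_cross c1 (dotC c x) xc (dotC c a) ac;
    rewrite xa !mulr0 subr0 oppr0.
have xap : dot (cross x a) p = 0.
  by rewrite (crossC x) dotNl dot_cross_cross a1 xc (dotC a x) xa ac;
    rewrite !mulr0 subr0 oppr0.
have a_xp : dot a (cross x p) = 0.
  by rewrite -dot_cross crossC dotNl xap oppr0.
have a_xc : dot a (cross x c) = 0 by rewrite -dot_cross crossC dotNl xac oppr0.
have c_xa : dot c (cross x a) = 0 by rewrite dotC.
have c_xp : dot c (cross x p) = 0 by rewrite -dot_cross.
have p_xc : dot p (cross x c) = 0 by rewrite dotC crossC dotNl cxp oppr0.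
have xx u v : dot x u = 0 -> dot (cross x u) (cross x v) = dot u v.
  by move=> xu; rewrite dot_cross_cross x1 xu mul1r mul0r subr0.
have [] : [/\ orthonormal_frame b, cross (b 0) (b 1) = b 3,
  cross (b 1) (b 2) = b 4 & cross (b 2) (b 3) = b 5] /\
 [/\ cross (b 3) (b 4) = b 6, cross (b 4) (b 5) = b 0,
  cross (b 5) (b 6) = b 1 & cross (b 6) (b 0) = b 2]; last first.
  move=> [bo h0 h1 h2] [h3 h4 h5 h6]; split=> // i.
  have bE (k l m k' l' m' : 'I_7) : cross (b k') (b l') = b m' ->
      k = k' :> nat -> l = l' :> nat -> m = m' :> nat -> cross (b k) (b l) = b m.
    by move=> H /val_inj -> /val_inj -> /val_inj ->.
  elim/forall_ord7: i.
  - exact: bE h0 _ _ _.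
  - exact: bE h1 _ _ _.
  - exact: bE h2 _ _ _.
  - exact: bE h3 _ _ _.
  - exact: bE h4 _ _ _.
  - exact: bE h5 _ _ _.
  - exact: bE h6 _ _ _.
have h2 : cross c (cross x a) = cross x p.
  by rewrite cross_orthoC ?(dotC c) // (crossC c) crossNr opprK.
have [b0 b1 b2] : [/\ b 0 = x, b 1 = a & b 2 = c] by [].
have [b3 b4 b5 b6] : [/\
    b 3 = cross x a, b 4 = p, b 5 = cross x p & b 6 = cross x c] by [].
clearbody b; split; last first.
  rewrite b0 b1 b2 b3 b4 b5 b6; split.
  - rewrite /p cross_orthoC ?(dotC _ a) ?dot_crossr //.
    rewrite (crossC _ c) h2 crossNr opprK cross_orthoC ?(dotC a x) //.
    by rewrite cross_unitK // crossNr opprK.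
  - by rewrite (crossC x) crossNr cross_unitK ?opprK // dotC.
  - rewrite crossC cross_orthoC ?(dotC (cross x c)) ?dot_crossl // opprK.
    rewrite (crossC _ p) cross_orthoC ?(dotC p) //.
    rewrite opprK (crossC p) /p (crossC a) !crossNr opprK (cross_unitK c1) ?(dotC c) //.
    by rewrite !crossNr cross_unitK // opprK.
  - by rewrite crossC cross_unitK ?opprK.
split; [|by rewrite b0 b1 b3|by rewrite b1 b2 b4|by rewrite b2 b3 b5].
move=> i j; wlog lij : i j / (i <= j)%N.
  by move=> H; have [/H //|/ltnW/H] := leqP i j; rewrite dotC eq_sym.
elim/forall_ord7: i lij; elim/forall_ord7: j => // _;
  rewrite ?(b0, b1, b2, b3, b4, b5, b6);
  by [exact: dot_crossl|exact: dot_crossr|rewrite xx|rewrite xx // dotC|].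
Qed.

(** A matrix with 7 rows and 3 columns has a nonzero left kernel; any nonzero vector of it,
    normalised, is orthogonal to the three columns. *)
Lemma unit_ortho3 u v w :
  exists c, [/\ dot c c = 1, dot u c = 0, dot v c = 0 & dot w c = 0].
Proof.
pose M : 'M[R]_(7, 3) := \matrix_(i, j) nth 0 [:: u; v; w] j i 0.
have kM : kermx M != 0.
  rewrite kermx_eq0 /row_free neq_ltn (leq_ltn_trans (rank_leq_col _)) //.
have [i ri] : exists i, row i (kermx M) != 0.
  by apply/existsP; apply: contraNT kM; rewrite negb_exists => /forallP r0;
    apply/eqP/row_matrixP => i; rewrite row0; apply/eqP; have := r0 i; rewrite negbK.
pose y : vec := (row i (kermx M))^T.
have y0 : 0 < dot y y by apply: dot_gt0; rewrite trmx_eq0.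
have yM (j : 'I_3) : dot (nth 0 [:: u; v; w] j) y = 0.
  have /matrixP/(_ 0 j) : row i (kermx M) *m M = 0.
    by rewrite -row_mul mulmx_ker row0.
  rewrite !mxE => <-; apply: eq_bigr => k _; rewrite !mxE mulrC //.
exists ((Num.sqrt (dot y y))^-1 *: y); rewrite dotZl !dotZr mulrA -invfM -expr2.
rewrite sqr_sqrtr ?ltW // mulVf ?gt_eqF //.
by rewrite (yM 0) (yM 1) (yM 2) !mulr0.
Qed.

End Frames.

(** * Invariant tensors *)

Section Invariants.
Variable R : realType.
Local Notation vec := 'cV[R]_7.
Implicit Types (u v w x a p : vec) (A : 'M[R]_7).
Local Notation e := (@std_frame R).

Lemma G2_dot A u v : G2 A -> dot (A *m u) (A *m v) = dot u v.
Proof. by move=> /G2P[]. Qed.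

Lemma G2_cross A u v : G2 A -> cross (A *m u) (A *m v) = A *m cross u v.
Proof. by move=> /G2P[]. Qed.

Lemma G2_triple x a c : dot x x = 1 -> dot a a = 1 -> dot c c = 1 ->
  dot x a = 0 -> dot x c = 0 -> dot a c = 0 -> dot (cross x a) c = 0 ->
  exists A, [/\ G2 A, A *m e 0 = x, A *m e 1 = a & A *m e 2 = c].
Proof.
move=> x1 a1 c1 xa xc ac xac; exists (frame_mx (triple_frame x a c)).
by rewrite !frame_mx_std; split=> //; exact/G2_frame_mx/triple_G2_frame.
Qed.

Lemma G2_pair x a : dot x x = 1 -> dot a a = 1 -> dot x a = 0 ->
  exists A, [/\ G2 A, A *m e 0 = x & A *m e 1 = a].
Proof.
move=> x1 a1 xa; have [c [c1 xc ac xac]] := unit_ortho3 x a (cross x a).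
by have [A [GA A0 A1 _]] := G2_triple x1 a1 c1 xa xc ac xac; exists A.
Qed.

Lemma dot_std u i : dot u (e i) = u i 0.
Proof.
rewrite /dot (bigD1 i) //= big1 => [|j /negPf ji]; last by rewrite !mxE ji mulr0.
by rewrite !mxE eqxx mulr1 addr0.
Qed.

Lemma std_dot i j : dot (e i) (e j) = (i == j)%:R.
Proof. exact: frame_dot (std_G2_frame R) i j. Qed.

Lemma cross_std (i j k : 'I_7) :
  i + 1 = j :> nat -> i + 3 = k :> nat -> cross (e i) (e j) = e k.
Proof. by move=> /val_inj <- /val_inj <-; exact: frame_cross (std_G2_frame R) i. Qed.

Lemma cross_std06 : cross (e 0) (e 2) = e 6.
Proof.
by rewrite -(@cross_std 6 0 2) // (crossC (e 6)) crossNr cross_unitK ?opprK ?std_dot.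
Qed.

Lemma cross_std05 : cross (e 0) (e 4) = e 5.
Proof.
by rewrite -(@cross_std 4 5 0) // crossC cross_unitK ?opprK ?std_dot.
Qed.

Lemma scale_unit u : u != 0 ->
  exists k a, [/\ 0 < k, dot a a = 1, u = k *: a & dot u u = k ^+ 2].
Proof.
move=> /dot_gt0 u0; have k0 : 0 < Num.sqrt (dot u u) by rewrite sqrtr_gt0.
exists (Num.sqrt (dot u u)), ((Num.sqrt (dot u u))^-1 *: u).
rewrite scalerA mulfV ?gt_eqF // scale1r sqr_sqrtr ?ltW //; split=> //.
by rewrite dotZl dotZr mulrA -invfM -expr2 sqr_sqrtr ?ltW // mulVf ?gt_eqF.
Qed.

Lemma S6_std0 : S6 (e 0).
Proof. by rewrite /S6 /= std_dot. Qed.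

Lemma tangent_std01 : tangent (e 0) (e 1).
Proof. by rewrite /tangent std_dot. Qed.

(** Transitivity on orthonormal pairs makes g p a a the same for all unit tangent vectors a at all
    points p. The quadratic form is then known by scaling, and the bilinear form by polarisation. *)
Lemma G2_invariant_metric (g : metric_field R) (J : endo_field R) :
  riemannian g -> G2_invariant g J ->
  exists2 c, 0 < c & forall p u v, S6 p -> tangent p u -> tangent p v ->
    g p u v = c * dot u v.
Proof.
move=> [gl gs gp _] [gA _]; exists (g (e 0) (e 1) (e 1)).
  apply: gp; [exact: S6_std0|exact: tangent_std01|].
  by apply/eqP => e10; have := std_dot 1 1; rewrite e10 dot0l => /esym/eqP;
    rewrite oner_eq0.
set c := g _ _ _; move=> p u v Sp.
have g0 w : tangent p w -> g p 0 w = 0.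
  move=> pw; have := gl p (-1) 0 0 w Sp (dot0r p) (dot0r p) pw.
  by rewrite scaler0 addr0 mulN1r addNr.
have gZ k w z : tangent p w -> tangent p z -> g p (k *: w) z = k * g p w z.
  move=> pw pz; have := gl p k w 0 z Sp pw (dot0r p) pz.
  by rewrite addr0 g0 ?addr0.
have gD w z y : tangent p w -> tangent p z -> tangent p y ->
    g p (w + z) y = g p w y + g p z y.
  by move=> pw pz py; have := gl p 1 w z y Sp pw pz py; rewrite scale1r mul1r.
have tD w z : tangent p w -> tangent p z -> tangent p (w + z).
  by rewrite /tangent dotDr => -> ->; rewrite addr0.
have tZ k w : tangent p w -> tangent p (k *: w).
  by rewrite /tangent dotZr => ->; rewrite mulr0.
have gq w : tangent p w -> g p w w = c * dot w w.
  have [->|/scale_unit[k [a [k0 a1 -> _]]]] := eqVneq w 0.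
    by rewrite dot0l mulr0 => ?; exact: g0.
  move=> pka; have pa : tangent p a.
    by have := tZ k^-1 _ pka; rewrite scalerA mulVf ?gt_eqF // scale1r.
  rewrite gZ // (gs _ a) // gZ //.
  rewrite dotZl dotZr a1 mulr1; have [A [GA <- <-]] := G2_pair Sp a1 pa.
  rewrite gA //; [|exact: S6_std0|exact: tangent_std01|exact: tangent_std01].
  by rewrite -/c mulrA mulrC.
move=> pu pv; have puv := tD _ _ pu pv; have := gq _ puv.
rewrite !(dotDl, dotDr) gD // (gs _ u (u + v)) // (gs _ v (u + v)) // !gD // !gq //.
by rewrite (gs _ v u) // (dotC v u); lra.
Qed.

Lemma G2_invariant_complex (g : metric_field R) (J : endo_field R) :
  almost_complex J -> G2_invariant g J ->
  exists2 s, s = 1 \/ s = - 1 & forall p u, S6 p -> tangent p u ->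
    J p u = s *: cross p u.
Proof.
move=> [Jt Jl JJ _] [_ JA].
pose w := J (e 0) (e 1).
(* This element also negates e_4, e_5 and e_6, as products of e_2 with fixed vectors or of e_4 with
   e_0. It fixes [w], whose coordinates along the negated vectors therefore vanish. *)
have [A [GA A0 A1 A2]] : exists A, [/\ G2 A, A *m e 0 = e 0, A *m e 1 = e 1 &
    A *m e 2 = - e 2].
  apply: G2_triple; rewrite ?(dotNl, dotNr, std_dot) ?opprK ?oppr0 //.
  by rewrite (@cross_std 0 1 3) // std_dot oppr0.
have Aw : A *m w = w.
  by rewrite /w -JA ?A0 ?A1 //; [exact: S6_std0|exact: tangent_std01].
have w_odd i : A *m e i = - e i -> w i 0 = 0.
  move=> Ai; have := G2_dot w (e i) GA; rewrite Aw Ai dotNr dot_std; lra.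
have w2 : w 2 0 = 0 by exact: w_odd.
have A4 : A *m e 4 = - e 4.
  by rewrite -(@cross_std 1 2 4) // -G2_cross // A1 A2 crossNr.
have w4 : w 4 0 = 0 by exact: w_odd.
have w5 : w 5 0 = 0 by apply: w_odd; rewrite -cross_std05 -G2_cross // A0 A4 crossNr.
have w6 : w 6 0 = 0 by apply: w_odd; rewrite -cross_std06 -G2_cross // A0 A2 crossNr.
(* The e_0-coordinate vanishes for another reason: J preserves the tangent space at e_0. *)
have w0 : w 0 0 = 0.
  by rewrite -dot_std dotC; apply: Jt; [exact: S6_std0|exact: tangent_std01].
have wE : w = w 1 0 *: e 1 + w 3 0 *: cross (e 0) (e 1).
  rewrite (@cross_std 0 1 3) //; apply: col7P.
  by apply: forall_ord7; rewrite !mxE /=;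
    rewrite ?(w0, w2, w4, w5, w6, mulr0, mulr1, addr0, add0r).
have Ja p a : S6 p -> tangent p a -> dot a a = 1 ->
    J p a = w 1 0 *: a + w 3 0 *: cross p a.
  move=> Sp pa a1; have [B [GB <- <-]] := G2_pair Sp a1 pa.
  rewrite JA //; [|exact: S6_std0|exact: tangent_std01].
  by rewrite -/w {1}wE mulmxDr -!scalemxAr G2_cross.
move: (w 1 0) (w 3 0) Ja => s t Ja.
have J0 p : S6 p -> J p 0 = 0.
  move=> Sp; have := Jl p (-1) 0 0 Sp (dot0r p) (dot0r p).
  by rewrite scaler0 addr0 scaleN1r addNr.
have JZ p k u : S6 p -> tangent p u -> J p (k *: u) = k *: J p u.
  by move=> Sp pu; have := Jl p k u 0 Sp pu (dot0r p); rewrite J0 // !addr0.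
have [s0 tt] : s = 0 /\ t ^+ 2 = 1.
  have S0 := S6_std0; have t1 := tangent_std01.
  have t3 : tangent (e 0) (e 3) by rewrite /tangent std_dot.
  have J1 : J (e 0) (e 1) = s *: e 1 + t *: e 3.
    by rewrite Ja ?std_dot // (@cross_std 0 1 3).
  have J3 : J (e 0) (e 3) = s *: e 3 - t *: e 1.
    rewrite Ja ?std_dot // -(@cross_std 0 1 3) // cross_unitK ?std_dot //.
    by rewrite scalerN.
  have := JJ _ _ S0 t1; rewrite J1 Jl ?JZ //; last first.
    by rewrite /tangent dotZr t3 mulr0.
  rewrite J1 J3 => /matrixP H.
  (* The coordinates of J (J e_1) = - e_1 along e_1 and e_3 say s^2 - t^2 = -1 and 2 s t = 0. The
     case t = 0 would make s^2 negative. *)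
  have := H 1 0; have := H 3 0; rewrite !mxE /=.
  rewrite !(mulr0, mulr1, addr0, add0r, subr0, oppr0) => H3 H1.
  have st : s * t = 0 by lra.
  have /eqP := st; rewrite mulf_eq0 => /orP[] /eqP z; last first.
    have := sqr_ge0 s; rewrite expr2; move: H1; rewrite z mul0r addr0 => ->.
    by rewrite oppr_ge0 ler10.
  by split=> //; rewrite z in H1; rewrite expr2; lra.
exists t.
  by move/eqP: tt; rewrite sqrf_eq1 => /orP[] /eqP ->; [left|right].
move=> p u Sp; have [->|/scale_unit[k [a [k0 a1 -> _]]]] := eqVneq u 0.
  by rewrite cross0r scaler0 => _; exact: J0.
move=> pka; have pa : tangent p a.
  by have := pka; rewrite /tangent dotZr => /eqP; rewrite mulf_eq0 gt_eqF //= => /eqP.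
by rewrite JZ // Ja // s0 scale0r add0r crossZr !scalerA mulrC.
Qed.

End Invariants.

(** * The isotropy group *)

Section Columns.
Variable F : comNzRingType.

Definition cols3 (Z1 Z2 Z3 : 'cV[F]_3) : 'M[F]_3 :=
  \matrix_(i, j) nth 0 [:: Z1; Z2; Z3] j i 0.

(** This scalar triple product is the form in which the complex volume appears when it is compared
    with the coordinates of [cross]. *)
Lemma det_cols3 (Z1 Z2 Z3 : 'cV[F]_3) : \det (cols3 Z1 Z2 Z3) =
  (Z1 1 0 * Z2 2 0 - Z1 2 0 * Z2 1 0) * Z3 0 0
  + (Z1 2 0 * Z2 0 0 - Z1 0 0 * Z2 2 0) * Z3 1 0
  + (Z1 0 0 * Z2 1 0 - Z1 1 0 * Z2 0 0) * Z3 2 0.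
Proof.
rewrite (expand_det_row _ 2) !big_ord_recr big_ord0 /= add0r.
rewrite /cofactor !(expand_det_row _ 0) !big_ord_recr !big_ord0 /= !add0r /cofactor.
rewrite !det_mx11 !mxE /=.
have -> : lift 2 0 = 0 :> 'I_3 by apply: val_inj.
have -> : lift 2 (lift 0 0) = 1 :> 'I_3 by apply: val_inj.
have -> : ((1 %% 3 + 1 %% 3) %% 3)%N = 2%N by [].
rewrite !exprD !expr0 !expr1 sqrrN expr1n; ring.
Qed.

Lemma mulmx_cols3 (U : 'M[F]_3) (Z1 Z2 Z3 : 'cV[F]_3) :
  U *m cols3 Z1 Z2 Z3 = cols3 (U *m Z1) (U *m Z2) (U *m Z3).
Proof.
apply/matrixP => i j; rewrite !mxE.
case: j => [[|[|[|//]]]] lj /=; rewrite mxE; by apply: eq_bigr => k _; rewrite !mxE.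
Qed.

Lemma cols3_mulmx (Z1 Z2 Z3 Z : 'cV[F]_3) :
  cols3 Z1 Z2 Z3 *m Z =
  \col_i (Z1 i 0 * Z 0 0 + Z2 i 0 * Z 1 0 + Z3 i 0 * Z 2 0).
Proof.
apply/matrixP => i j; rewrite ord1 !mxE !big_ord_recr big_ord0 /= add0r !mxE /=.
by congr (_ * Z _ 0 + _ * Z _ 0 + _ * Z _ 0); apply: val_inj.
Qed.

End Columns.

Section Isotropy.
Variable R : realType.
Local Notation vec := 'cV[R]_7.
Local Notation C := R[i].
Implicit Types (u v w x a p : vec) (A : 'M[R]_7) (Z W : 'cV[C]_3).
Local Notation e := (@std_frame R).
Local Notation z := (@complex_coords R).

(* On tangent vectors at e_0, hprod is the Hermitian form whose real part is
   dot, and det (z u, z v, z w) = hprod (z w) (z (cross u v)). *)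
Definition hprod Z W : C := (map_mx Num.conj W^T *m Z) 0 0.

Lemma hprodE Z W : hprod Z W = Z 0 0 * conjc (W 0 0) + Z 1 0 * conjc (W 1 0)
  + Z 2 0 * conjc (W 2 0).
Proof.
rewrite /hprod mxE (eq_bigr (fun k => Z k 0 * conjc (W k 0))) => [|k _]; last first.
  by rewrite !mxE mulrC.
rewrite !big_ord_recr big_ord0 /= add0r.
by congr (Z _ 0 * conjc (W _ 0) + Z _ 0 * conjc (W _ 0) + Z _ 0 * conjc (W _ 0));
  apply: val_inj.
Qed.

Lemma zE u : ((z u 0 0 = (u 1 0 +i* u 3 0)%C) * (z u 1 0 = (u 2 0 +i* u 6 0)%C)
  * (z u 2 0 = (u 4 0 +i* u 5 0)%C))%type.
Proof. by rewrite !mxE. Qed.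

Lemma hprod_z u v : hprod (z u) (z v) =
  ((dot u v - u 0 0 * v 0 0) +i* - cross u v 0 0)%C.
Proof.
rewrite hprodE !zE crossE dotE; simpc; apply/eqP; rewrite eq_complex /=.
by apply/andP; split; apply/eqP; ring.
Qed.

(** The last two terms account for the e_0-components of u and v: multiplication by e_0 acts as i in
    complex coordinates, and i leaves the conjugate-linear second slot as -i. *)
Lemma hprod_cross u v w : hprod (z w) (z (cross u v)) =
  \det (cols3 (z u) (z v) (z w)) - 'i%C * (u 0 0)%:C%C * hprod (z w) (z v)
  + 'i%C * (v 0 0)%:C%C * hprod (z w) (z u).
Proof.
rewrite !hprodE det_cols3 !zE !crossE; simpc; apply/eqP; rewrite eq_complex /=.
by apply/andP; split; apply/eqP; ring.
Qed.

Lemma col3P Z W : Z 0 0 = W 0 0 -> Z 1 0 = W 1 0 -> Z 2 0 = W 2 0 -> Z = W.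
Proof.
move=> h0 h1 h2; apply/matrixP => i j; rewrite ord1.
have E (k : 'I_3) : Z k 0 = W k 0 -> i = k :> nat -> Z i 0 = W i 0.
  by move=> Zk /val_inj ->.
by case: i E => [[|[|[|//]]]] li E; [exact: E h0 _|exact: E h1 _|exact: E h2 _].
Qed.

Lemma zP u v : u 0 0 = v 0 0 -> z u = z v -> u = v.
Proof.
move=> uv0 /matrixP uv.
have := uv 0 0; have := uv 1 0; have := uv 2 0; rewrite !zE.
by move=> [? ?] [? ?] [? ?]; apply: col7P; apply: forall_ord7.
Qed.

Lemma z_e0 : z (e 0) = 0.
Proof. by apply: col3P; rewrite zE !mxE. Qed.

Lemma cols3_z_std : cols3 (z (e 1)) (z (e 2)) (z (e 4)) = 1%:M.
Proof.
apply/matrixP => i j; rewrite !mxE.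
by case: i => [[|[|[|//]]]] li; case: j => [[|[|[|//]]]] lj; rewrite /= !mxE.
Qed.

Lemma hprod_mulmx (U : 'M[C]_3) Z W : map_mx Num.conj U^T *m U = 1%:M ->
  hprod (U *m Z) (U *m W) = hprod Z W.
Proof.
by move=> U1; rewrite /hprod trmx_mul map_mxM mulmxA -(mulmxA _ _ U) U1 mulmx1.
Qed.

Lemma gram_cols3 Z1 Z2 Z3 : map_mx Num.conj (cols3 Z1 Z2 Z3)^T *m cols3 Z1 Z2 Z3 =
  \matrix_(i, j) hprod (nth 0 [:: Z1; Z2; Z3] j) (nth 0 [:: Z1; Z2; Z3] i).
Proof.
apply/matrixP => i j; rewrite /hprod !mxE; apply: eq_bigr => k _.
by rewrite !mxE.
Qed.

Section Fixing.
Variable A : 'M[R]_7.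
Hypotheses (GA : G2 A) (A0 : A *m e 0 = e 0).

Lemma fix_coord0 u : (A *m u) 0 0 = u 0 0.
Proof. by rewrite -!dot_std -{1}A0 G2_dot. Qed.

Lemma fix_hprod u v : hprod (z (A *m u)) (z (A *m v)) = hprod (z u) (z v).
Proof. by rewrite !hprod_z G2_dot // G2_cross // !fix_coord0. Qed.

Lemma z_cross_e0 u : z (cross (e 0) u) = 'i%C *: z u.
Proof.
by apply: col3P; rewrite [RHS]mxE !zE !crossE !mxE /=; simpc;
  rewrite ?(mul1r, mul0r, subr0, sub0r, addr0, add0r).
Qed.

Lemma zD u v : z (u + v) = z u + z v.
Proof. by apply: col3P; rewrite [RHS]mxE !zE !mxE; simpc. Qed.

Lemma zZ k u : z (k *: u) = k%:C%C *: z u.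
Proof. by apply: col3P; rewrite [RHS]mxE !zE !mxE; simpc. Qed.

(** The basis is grouped into e_1, e_2, e_4 and their images under e_0, which exhibits the complex
    basis of the orthogonal complement of e_0. *)
Lemma std_split u : u = u 0 0 *: e 0 +
  (u 1 0 *: e 1 + u 3 0 *: cross (e 0) (e 1) +
  (u 2 0 *: e 2 + u 6 0 *: cross (e 0) (e 2)) +
  (u 4 0 *: e 4 + u 5 0 *: cross (e 0) (e 4))).
Proof.
rewrite (@cross_std _ 0 1 3) // cross_std05 cross_std06.
apply: col7P; apply: forall_ord7; rewrite !mxE /=.
all: by rewrite ?(mulr0, mulr1, addr0, add0r).
Qed.

(** An automorphism fixing e_0 commutes with multiplication by e_0, hence is complex linear on the
    orthogonal complement of e_0; its columns are the images of the complex basis. *)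
Lemma fix_complex u :
  z (A *m u) = cols3 (z (A *m e 1)) (z (A *m e 2)) (z (A *m e 4)) *m z u.
Proof.
rewrite {1}(std_split u) !mulmxDr -!scalemxAr -!G2_cross // A0.
rewrite !(zD, zZ) !z_cross_e0 z_e0 cols3_mulmx !zE scaler0 add0r !scalerA -!scalerDl.
move: (z _) (z _) (z _) => Z1 Z2 Z4; apply/matrixP => i j; rewrite ord1 !mxE.
by congr (_ + _ + _); rewrite mulrC; congr (_ * _); simpc.
Qed.

End Fixing.

(** The Hermitian form encodes [dot] and the e_0-component of [cross]; the determinant encodes the
    rest of [cross]. Preserving both is the same as being in G_2 and fixing e_0. *)
Lemma isotropy_SU3 A : G2 A /\ A *m e 0 = e 0 <->
  exists2 U : 'M[C]_3, SU3 U & forall x : vec, (A *m x) 0 0 = x 0 0 /\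
            z (A *m x) = U *m z x.
Proof.
split=> [[GA A0]|[U [U1 U2] AU]].
  exists (cols3 (z (A *m e 1)) (z (A *m e 2)) (z (A *m e 4))); last first.
    by move=> x; rewrite fix_coord0 // -fix_complex.
  split.
    apply/unitarymxP/mulmx1C.
    (* The identity is seen as the Gram matrix of the coordinates of e_1, e_2, e_4, so that
       unitarity becomes an equality of Gram matrices. *)
    have <- : map_mx Num.conj (1%:M)^T *m 1%:M = 1%:M :> 'M[C]_3.
      by rewrite mulmx1 trmx1 map_mx1.
    rewrite -cols3_z_std !gram_cols3; apply/matrixP => i j.
    rewrite [LHS]mxE [RHS]mxE.
    by case: i => [[|[|[|//]]]] li; case: j => [[|[|[|//]]]] lj; exact: fix_hprod.
  (* The right-hand side does not involve [B], so the determinant for [A] equals the one for the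
     identity matrix, which is 1. *)
  have H (B : 'M[R]_7) : G2 B -> B *m e 0 = e 0 ->
      \det (cols3 (z (B *m e 1)) (z (B *m e 2)) (z (B *m e 4))) =
      hprod (z (e 4)) (z (cross (e 1) (e 2))).
    move=> GB B0; rewrite -(fix_hprod GB B0) -G2_cross // hprod_cross.
    rewrite !fix_coord0 // !mxE /= !(complexr0, mulr0, mul0r) subr0 addr0 //.
  rewrite H // -(H 1%:M) ?mul1mx ?cols3_z_std ?det1 //.
  by apply/G2P; split=> u v; rewrite !mul1mx.
have {U1} U1 : map_mx Num.conj U^T *m U = 1%:M by apply/mulmx1C/unitarymxP.
have A0 x : (A *m x) 0 0 = x 0 0 by have [] := AU x.
have {}AU x : z (A *m x) = U *m z x by have [] := AU x.
have Ah u v : hprod (z (A *m u)) (z (A *m v)) = hprod (z u) (z v).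
  by rewrite !AU hprod_mulmx.
have Ad u v : dot (A *m u) (A *m v) = dot u v.
  by have := Ah u v; rewrite !hprod_z !A0 => -[/addIr].
have Ac u v : cross (A *m u) (A *m v) 0 0 = cross u v 0 0.
  by have := Ah u v; rewrite !hprod_z => -[_ /oppr_inj].
have A3 u v w : hprod (z (A *m w)) (z (cross (A *m u) (A *m v))) =
    hprod (z w) (z (cross u v)).
  by rewrite !hprod_cross !Ah !A0 !AU -mulmx_cols3 det_mulmx U2 mul1r.
have AT : A^T *m A = 1%:M.
  apply: mulmx_ext => u; apply: dot_inj => w.
  by rewrite -mulmxA dotC -dot_mull Ad mul1mx dotC.
split; last by apply: zP; rewrite ?A0 // AU z_e0 mulmx0.
apply/G2P; split=> // u v; apply: dot_inj => w.
(* Since A is orthogonal, every test vector lies in its image, where [A3] applies; the real part of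
   [A3] then gives the equality of inner products. *)
have -> : w = A *m (A^T *m w) by rewrite mulmxA (mulmx1C AT) mul1mx.
rewrite Ad; move: (A^T *m w) => {}w; rewrite dotC [RHS]dotC.
have := A3 u v w; rewrite !hprod_z A0 Ac.
by move=> -[/addIr].
Qed.

(** * Transitivity of G_2 on the sphere *)

Lemma G2_mul A B : G2 A -> G2 B -> G2 (A *m B).
Proof.
by move=> GA GB; apply/G2P; split=> u v; rewrite -!mulmxA ?G2_dot // !G2_cross.
Qed.

Lemma G2_inv A : G2 A -> G2 (invmx A).
Proof.
move=> GA; have uA : A \in unitmx by case: GA.
have AK (w : 'cV[R]_7) : A *m (invmx A *m w) = w by rewrite mulmxA mulmxV // mul1mx.
apply/G2P; split=> u v; first by rewrite -[LHS](G2_dot _ _ GA) !AK.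
by apply: (can_inj (mulKmx uA)); rewrite -[LHS](G2_cross _ _ GA) !AK.
Qed.

Lemma S6_homogeneous : S6_is_G2_mod_SU3 R.
Proof.
split=> [A x GA|x y Sx Sy|A]; last exact: isotropy_SU3.
  by rewrite /S6 /= G2_dot.
have T u : S6 u -> exists2 A, G2 A & A *m e 0 = u.
  move=> Su; have [a [a1 ua _ _]] := unit_ortho3 u u u.
  by have [A [GA A0 _]] := G2_pair Su a1 ua; exists A.
have [A GA <-] := T _ Sx; have [B GB <-] := T _ Sy.
exists (B *m invmx A); first exact/G2_mul/G2_inv.
by rewrite -mulmxA mulKmx //; case: GA.
Qed.

End Isotropy.

(** * Functions of class C^k *)

Section DifferentialCalculus.
Variable R : realType.
Variables V W : normedModType R.
Implicit Types (U : set V) (f g : V -> W).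

(** The first-order expansion of f at x is also one of g, and uniqueness of the differential turns
    it into differentiability of g. *)
Lemma near_eq_differentiable f g (x : V) :
  {near x, f =1 g} -> differentiable f x -> differentiable g x.
Proof.
move=> fg df; have [dfc fE] := (diff_locallyP _ _).1 df.
have gE : g \o shift x = cst (g x) + 'd f x +o_ 0 id.
  have fgx := nbhs_singleton fg.
  apply/eqaddoP => _ /posnumP[eps].
  have /eqaddoP/(_ _ (gt0 eps)) := fE.
  have : \forall h \near 0, f (h + x) = g (h + x).
    have : \forall y \near x, f y = g y by exact: fg.
    by rewrite (near_shift 0) subr0.
  apply: filterS2 => h fgh; rewrite /= !fctE /= -fgh -fgx //.
have dgf := diff_unique dfc gE.
by apply/diff_locallyP; rewrite dgf.
Qed.

Lemma derive_open U f g (x v : V) : open U -> U x ->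
  (forall y, U y -> f y = g y) -> 'D_v f x = 'D_v g x.
Proof.
by move=> oU Ux fg; apply: near_eq_derive; apply: filterS (open_nbhs_nbhs (conj oU Ux)).
Qed.

(** Openness lets the equality on [U] pass to directional derivatives, which depend on values near
    the point. *)
Lemma eq_Ck k U f g : open U -> (forall x, U x -> f x = g x) -> Ck k U f -> Ck k U g.
Proof.
move=> oU; elim: k f g => [|k IH] f g fg /=.
  move=> fc x Ux; rewrite /prop_for /continuous_at -(fg x Ux).
  apply: cvg_trans (fc x Ux); apply: near_eq_cvg.
  by apply: filterS (open_nbhs_nbhs (conj oU Ux)) => y /fg ->.
move=> [df Df]; split=> [x Ux|v].
  apply: near_eq_differentiable (df x Ux).
  by apply: filterS (open_nbhs_nbhs (conj oU Ux)).
by apply: IH (Df v) => x Ux; exact: derive_open oU Ux fg.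
Qed.

Lemma CkW k U f : Ck k.+1 U f -> Ck k U f.
Proof.
elim: k f => [|k IH] f [df Df].
  by move=> x Ux; apply: differentiable_continuous; exact: df.
by split=> // v; apply: IH.
Qed.

Lemma sub_Ck k U U' f : U' `<=` U -> Ck k U f -> Ck k U' f.
Proof.
move=> UU'; elim: k f => [|k IH] f /=; first by move=> fc x /UU'; exact: fc.
by move=> [df Df]; split=> [x /UU'|v]; [exact: df|exact: IH].
Qed.

Lemma CkD k U f g : open U -> Ck k U f -> Ck k U g -> Ck k U (fun x => f x + g x).
Proof.
move=> oU; elim: k f g => [|k IH] f g /=.
  by move=> fc gc x Ux; apply: continuousD; [exact: fc|exact: gc].
move=> [df Df] [dg Dg]; split=> [x Ux|v].
  by apply: differentiableD; [exact: df|exact: dg].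
apply: eq_Ck (IH _ _ (Df v) (Dg v)) => // x Ux.
by rewrite deriveD //; apply: diff_derivable; [exact: df|exact: dg].
Qed.

Lemma Ck_cst k U (w : W) : Ck k U (fun=> w).
Proof.
elim: k w => [|k IH] w /=; first by move=> x _; exact: cst_continuous.
split=> [x _|v]; first exact: differentiable_cst.
by under eq_fun do rewrite derive_cst; exact: IH.
Qed.

Lemma Ck_sum k U (I : Type) (r : seq I) (f : I -> V -> W) : open U ->
  (forall i, Ck k U (f i)) -> Ck k U (fun x => \sum_(i <- r) f i x).
Proof.
move=> oU Cf; elim: r => [|i r IH].
  by under eq_fun do rewrite big_nil; exact: Ck_cst.
by under eq_fun do rewrite big_cons; exact: CkD.
Qed.

Lemma Ck_linear k U (f : {linear V -> W}) : continuous f -> Ck k U f.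
Proof.
move=> fc; case: k => [|k] /=; first by move=> x _; exact: fc.
split=> [x _|v]; first exact: linear_differentiable.
rewrite (_ : (fun x => _) = fun=> f v); first exact: Ck_cst.
apply/funext => x; rewrite deriveE; last exact: linear_differentiable.
by rewrite diff_lin.
Qed.

End DifferentialCalculus.

(** * The Leibniz rule for continuous bilinear maps *)

Section Bilinear.
Variable R : realType.
Variables V W1 W2 W : normedModType R.
Variable B : {bilinear W1 -> W2 -> W}.
Hypothesis B_continuous : continuous (fun p => B p.1 p.2).

Lemma differentiable_bilin_comp (f : V -> W1) (g : V -> W2) x :
  differentiable f x -> differentiable g x ->
  differentiable (fun y => B (f y) (g y)) x.
Proof.
move=> df dg; rewrite -[fun y => _]/((fun p => B p.1 p.2) \o (fun y => (f y, g y))).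
apply: differentiable_comp; first exact: differentiable_pair.
exact: differentiable_bilin.
Qed.

Lemma derive_bilin (f : V -> W1) (g : V -> W2) x v :
  differentiable f x -> differentiable g x ->
  'D_v (fun y => B (f y) (g y)) x = B ('D_v f x) (g x) + B (f x) ('D_v g x).
Proof.
move=> df dg; rewrite !deriveE //; last exact: differentiable_bilin_comp.
rewrite -[fun y => _]/((fun p => B p.1 p.2) \o (fun y => (f y, g y))).
rewrite diff_comp; [|exact: differentiable_pair|exact: differentiable_bilin].
by rewrite /= diff_bilin // diff_pair //= addrC.
Qed.

(** In each term of the Leibniz rule one factor has lost an order of differentiability; the other is
    weakened by [CkW] to meet the induction hypothesis. *)
Lemma Ck_bilin k U (f : V -> W1) (g : V -> W2) : open U ->
  Ck k U f -> Ck k U g -> Ck k U (fun x => B (f x) (g x)).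
Proof.
move=> oU; elim: k f g => [|k IH] f g.
  move=> fc gc x Ux.
  apply: (@continuous_comp _ _ _ (fun y => (f y, g y)) (fun p => B p.1 p.2)).
    by apply: cvg_pair; [exact: fc|exact: gc].
  exact: B_continuous.
move=> Cf Cg; have [df Df] := Cf; have [dg Dg] := Cg; split=> [x Ux|v].
  by apply: differentiable_bilin_comp; [exact: df|exact: dg].
apply: (@eq_Ck _ _ _ _ _ (fun x => B ('D_v f x) (g x) + B (f x) ('D_v g x))) => //.
  by move=> x Ux; rewrite derive_bilin //; [exact: df|exact: dg].
by apply: CkD => //; [exact: IH (Df v) (CkW Cg)|exact: IH (CkW Cf) (Dg v)].
Qed.

End Bilinear.

(** * Differentials of maps on the sphere *)

Section SphereCalculus.
Variable R : realType.
Local Notation vec := 'cV[R]_7.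
Local Notation e := (@std_frame R).
Implicit Types (p q u v x : vec).

(** In the standard basis the map is a finite sum of products of coordinates with fixed vectors. *)
Lemma bilinear_continuous (W : normedModType R) (B : {bilinear vec -> vec -> W}) :
  continuous (fun w : vec * vec => B w.1 w.2).
Proof.
have -> : (fun w : vec * vec => B w.1 w.2) =
    (fun w => \sum_i \sum_j w.1 i 0 *: (w.2 j 0 *: B (e i) (e j))).
  apply/funext => -[u v] /=; rewrite {1}(std_frame_sum u) linear_sumlz.
  apply: eq_bigr => i _; rewrite linearZl_LR {1}(std_frame_sum v) linear_sumr.
  by rewrite scaler_sumr; apply: eq_bigr => j _; rewrite linearZr_LR.
move=> uv; apply: cvg_big; [exact: add_continuous|] => i _.
apply: cvg_big; [exact: add_continuous|] => j _.
apply: cvgZ; first exact: (continuous_comp cvg_fst (@coord_continuous _ _ _ i 0 _)).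
apply: cvgZ; last exact: cvg_cst.
exact: (continuous_comp cvg_snd (@coord_continuous _ _ _ j 0 _)).
Qed.

Lemma linear_continuous_vec (W : normedModType R) (f : {linear vec -> W}) :
  continuous f.
Proof.
have -> : (f : vec -> W) = (fun u => \sum_i u i 0 *: f (e i)).
  apply/funext => u /=; rewrite {1}(std_frame_sum u) linear_sum.
  by apply: eq_bigr => i _; rewrite linearZ.
move=> u; apply: cvg_big; [exact: add_continuous|exact: nbhs_filter|move=> i _].
exact: (cvgZ (@coord_continuous _ _ _ i 0 u) (cvg_cst (f (e i)))).
Qed.

Lemma dot_is_bilinear : bilinear_for
  (GRing.Scale.Law.clone _ _ *:%R _) (GRing.Scale.Law.clone _ _ *:%R _)
  (@dot R : vec -> vec -> R^o).
Proof.
split=> [w|w] k x y /=; first by rewrite dotDl dotZl.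
by rewrite dotDr dotZr.
Qed.
HB.instance Definition _ :=
  bilinear_isBilinear.Build R vec vec R^o _ _ (@dot R) dot_is_bilinear.

Lemma cross_is_bilinear : bilinear_for
  (GRing.Scale.Law.clone _ _ *:%R _) (GRing.Scale.Law.clone _ _ *:%R _)
  (@cross R).
Proof.
split=> [w|w] k x y /=; first by rewrite crossDl crossZl.
by rewrite crossDr crossZr.
Qed.
HB.instance Definition _ :=
  bilinear_isBilinear.Build R vec vec vec _ _ (@cross R) cross_is_bilinear.

(** A named two-argument form of scalar multiplication to which a bilinear structure can be
    attached, so that the Leibniz rule covers a function times a field. *)
Definition scale (W : normedModType R) (k : R^o) (w : W) : W := k *: w.

Lemma scale_is_bilinear W : bilinear_for
  (GRing.Scale.Law.clone _ _ *:%R _) (GRing.Scale.Law.clone _ _ *:%R _)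
  (@scale W).
Proof.
split=> [w|w] k x y /=; first by rewrite /scale scalerDl scalerA.
by rewrite /scale scalerDr !scalerA mulrC.
Qed.
HB.instance Definition _ (W : normedModType R) :=
  bilinear_isBilinear.Build R R^o W W _ _ (@scale W) (@scale_is_bilinear W).

Lemma dot_continuous : continuous (fun w : vec * vec => dot w.1 w.2 : R^o).
Proof. exact: (@bilinear_continuous R^o (@dot R)). Qed.

Lemma cross_continuous : continuous (fun w : vec * vec => cross w.1 w.2).
Proof. exact: (@bilinear_continuous _ (@cross R)). Qed.

Lemma scale_bilin_continuous (W : normedModType R) :
  continuous (fun w : R^o * W => scale w.1 w.2).
Proof. exact: scale_continuous. Qed.

Lemma differentiable_dot_sqr x : differentiable (fun x : vec => dot x x : R^o) x.
Proof.
by apply: (@differentiable_bilin_comp _ _ _ _ _ (@dot R : vec -> vec -> R^o)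
  dot_continuous id id).
Qed.

Lemma dot_sqr_continuous : continuous (fun x : vec => dot x x : R^o).
Proof. by move=> x; exact/differentiable_continuous/differentiable_dot_sqr. Qed.

Lemma normalize_id p : S6 p -> normalize p = p.
Proof. by rewrite /normalize => ->; rewrite sqrtr1 invr1 scale1r. Qed.

Lemma normalize_S6 x : 0 < dot x x -> S6 (normalize x).
Proof.
move=> x0; rewrite /S6 /= dotZl dotZr mulrA -invfM -expr2 sqr_sqrtr ?ltW //.
by rewrite mulVf ?gt_eqF.
Qed.

Lemma near_normalize_S6 p : S6 p -> \forall x \near p, S6 (normalize x).
Proof.
move=> Sp; have : \forall x \near p, 0 < dot x x.
  by apply: (cvgr_gt _ (@dot_sqr_continuous p)); rewrite Sp ltr01.
by apply: filterS => x; exact: normalize_S6.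
Qed.

Let invsqrt (t : R) : R^o := (Num.sqrt t)^-1.

Lemma differentiable_invsqrt : differentiable (invsqrt : R^o -> R^o) (1 : R^o).
Proof.
apply: differentiableV; last by rewrite sqrtr1 oner_eq0.
by apply/derivable1_diffP; apply: ex_derive; apply: is_derive1_sqrt.
Qed.

Lemma differentiable_inv_norm p : S6 p ->
  differentiable (fun x => invsqrt (dot x x)) p.
Proof.
move=> Sp; apply: (@differentiable_comp _ _ _ _ (fun x : vec => dot x x : R^o) invsqrt).
  exact: differentiable_dot_sqr.
by rewrite Sp; exact: differentiable_invsqrt.
Qed.

Lemma differentiable_normalize p : S6 p -> differentiable (@normalize R) p.
Proof.
move=> Sp; apply: (@differentiable_bilin_comp _ _ _ _ _ (@scale _)
  (@scale_bilin_continuous _) (fun x : vec => invsqrt (dot x x)) id) => //.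
exact: differentiable_inv_norm.
Qed.

(** The squared norm has derivative 2 (p . v) = 0 along v, so the radial factor is stationary and
    only the derivative of the identity remains. *)
Lemma derive_normalize p v : S6 p -> tangent p v -> 'D_v (@normalize R) p = v.
Proof.
move=> Sp pv; have dn := differentiable_inv_norm Sp.
have -> : 'D_v (@normalize R) p =
    'D_v (fun x => scale (invsqrt (dot x x)) x) p by [].
rewrite (@derive_bilin _ _ _ _ _ (@scale _) (@scale_bilin_continuous _)
  (fun x : vec => invsqrt (dot x x)) id) //.
suff -> : 'D_v (fun x => invsqrt (dot x x)) p = 0.
  by rewrite derive_id linear0l add0r /scale /= Sp /invsqrt sqrtr1 invr1; exact: scale1r.
have d0 : 'd (fun x : vec => dot x x : R^o) p v = 0.
  rewrite -deriveE; last exact: differentiable_dot_sqr.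
  rewrite (@derive_bilin _ _ _ _ _ (@dot R : vec -> vec -> R^o)
    dot_continuous id id) // derive_id.
  by change (dot v p + dot p v = 0); rewrite (dotC v) pv addr0.
have di : differentiable invsqrt (dot p p) by rewrite Sp; exact: differentiable_invsqrt.
rewrite (deriveE _ dn) (diff_comp (@differentiable_dot_sqr p) di) /= d0.
exact: linear0.
Qed.

Section Differential.
Variable W : normedModType R.
Implicit Types f g : vec -> W.

Lemma eq_dS f g p v : S6 p -> (forall x, S6 x -> f x = g x) -> dS f p v = dS g p v.
Proof.
move=> Sp fg; apply: near_eq_derive; apply: filterS (near_normalize_S6 Sp) => x.
exact: fg.
Qed.

(** Near p the maps f and F agree after normalisation, and normalisation has the identity as
    differential on tangent vectors; the chain rule concludes. This makes any local extension usable
    for computing differentials on the sphere. *)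
Lemma dS_ext f (F : vec -> W) U p v : open U -> U p -> S6 p -> tangent p v ->
  (forall x, U x -> S6 x -> F x = f x) -> differentiable F p ->
  dS f p v = 'D_v F p.
Proof.
move=> oU Up Sp pv Ff dF; have dn := differentiable_normalize Sp.
transitivity ('D_v (F \o @normalize R) p).
  apply: near_eq_derive.
  have nU : \forall x \near p, U (normalize x).
    apply: (differentiable_continuous dn); rewrite normalize_id //.
    exact: open_nbhs_nbhs.
  apply: filterS2 nU (near_normalize_S6 Sp) => x Ux Sx /=.
  by rewrite Ff.
have dF' : differentiable F (normalize p) by rewrite normalize_id.
have nv : 'd (@normalize R) p v = v by rewrite -(deriveE _ dn) (derive_normalize Sp pv).
rewrite (deriveE _ (differentiable_comp dn dF')) (deriveE _ dF) (diff_comp dn dF') /=.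
by rewrite nv normalize_id.
Qed.

Lemma smooth_differentiable U (F : vec -> W) x :
  smooth_on U F -> U x -> differentiable F x.
Proof. by move=> sF; have [dF _] := sF 1%N; exact: dF. Qed.

Lemma dS_linear f p (a : R) u v : smoothS f -> S6 p -> tangent p u -> tangent p v ->
  dS f p (a *: u + v) = a *: dS f p u + dS f p v.
Proof.
move=> sf Sp pu pv; have [U [F [oU Up sF Ff]]] := sf p Sp.
have dF := smooth_differentiable sF Up.
have puv : tangent p (a *: u + v) by rewrite /tangent dotDr dotZr pu pv mulr0 addr0.
rewrite !(dS_ext oU Up Sp _ Ff dF) // !(deriveE _ dF).
exact: linearP.
Qed.

Lemma smoothS_cst (w : W) : smoothS (fun=> w).
Proof.
move=> p _; exists setT, (fun=> w); split=> //; first exact: openT.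
by move=> k; exact: Ck_cst.
Qed.

Lemma dS_cst (w : W) p v : dS (fun=> w) p v = 0.
Proof. by rewrite /dS derive_cst. Qed.

Lemma smoothS_linear (f : {linear vec -> W}) : smoothS f.
Proof.
move=> p _; exists setT, f; split=> //; first exact: openT.
by move=> k; apply: Ck_linear; exact: linear_continuous_vec.
Qed.

Lemma dS_lin (f : {linear vec -> W}) p v : S6 p -> tangent p v -> dS f p v = f v.
Proof.
move=> Sp pv; have fc := @linear_continuous_vec _ f.
have df : differentiable f p by exact: linear_differentiable.
rewrite (dS_ext openT I Sp pv (fun _ _ _ => erefl) df) (deriveE _ df).
by rewrite diff_lin.
Qed.

Lemma smoothSD f g : smoothS f -> smoothS g -> smoothS (fun x => f x + g x).
Proof.
move=> sf sg p Sp; have [U [F [oU Up sF Ff]]] := sf p Sp.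
have [U' [G [oU' U'p sG Gg]]] := sg p Sp.
exists (U `&` U'), (fun x => F x + G x); split=> //; first exact: openI.
  move=> k; apply: CkD; first exact: openI.
    exact: sub_Ck (sF k).
  exact: sub_Ck (sG k).
by move=> x [Ux U'x] Sx; rewrite Ff ?Gg.
Qed.

Lemma dSD f g p v : smoothS f -> smoothS g -> S6 p -> tangent p v ->
  dS (fun x => f x + g x) p v = dS f p v + dS g p v.
Proof.
move=> sf sg Sp pv; have [U [F [oU Up sF Ff]]] := sf p Sp.
have [U' [G [oU' U'p sG Gg]]] := sg p Sp.
have dF := smooth_differentiable sF Up; have dG := smooth_differentiable sG U'p.
rewrite (dS_ext oU Up Sp pv Ff dF) (dS_ext oU' U'p Sp pv Gg dG).
have FG x : (U `&` U') x -> S6 x -> F x + G x = f x + g x.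
  by move=> [Ux U'x] Sx; rewrite Ff ?Gg.
rewrite (dS_ext (openI oU oU') (conj Up U'p) Sp pv FG (differentiableD dF dG)).
by rewrite deriveD //; exact: diff_derivable.
Qed.

End Differential.

Section BilinearSphere.
Variables W1 W2 W : normedModType R.
Variable B : {bilinear W1 -> W2 -> W}.
Hypothesis B_continuous : continuous (fun w => B w.1 w.2).

Lemma smoothS_bilin f g : smoothS f -> smoothS g -> smoothS (fun x => B (f x) (g x)).
Proof.
move=> sf sg p Sp; have [U [F [oU Up sF Ff]]] := sf p Sp.
have [U' [G [oU' U'p sG Gg]]] := sg p Sp.
exists (U `&` U'), (fun x => B (F x) (G x)); split=> //; first exact: openI.
  move=> k; apply: Ck_bilin => //; first exact: openI.
    exact: sub_Ck (sF k).
  exact: sub_Ck (sG k).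
by move=> x [Ux U'x] Sx; rewrite Ff ?Gg.
Qed.

Lemma dS_bilin f g p v : smoothS f -> smoothS g -> S6 p -> tangent p v ->
  dS (fun x => B (f x) (g x)) p v = B (dS f p v) (g p) + B (f p) (dS g p v).
Proof.
move=> sf sg Sp pv; have [U [F [oU Up sF Ff]]] := sf p Sp.
have [U' [G [oU' U'p sG Gg]]] := sg p Sp.
have dF := smooth_differentiable sF Up; have dG := smooth_differentiable sG U'p.
rewrite (dS_ext oU Up Sp pv Ff dF) (dS_ext oU' U'p Sp pv Gg dG).
have FG x : (U `&` U') x -> S6 x -> B (F x) (G x) = B (f x) (g x).
  by move=> [Ux U'x] Sx; rewrite Ff ?Gg.
rewrite (dS_ext (openI oU oU') (conj Up U'p) Sp pv FG);
  last exact: differentiable_bilin_comp.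
by rewrite (derive_bilin B_continuous _ dF dG) Ff ?Gg.
Qed.

End BilinearSphere.

(** Smoothness is phrased with derivatives in fixed directions, whereas here the direction varies.
    Expanding it in the standard basis leaves partial derivatives of an extension of f, with the
    coordinates of an extension of X as coefficients. *)
Lemma smoothS_dS (W : normedModType R) (f X : vec -> _) :
  smoothS f -> vector_field X -> smoothS (fun q => dS f q (X q) : W).
Proof.
move=> sf [tX sX] p Sp; have [U [F [oU Up sF Ff]]] := sf p Sp.
have [U' [G [oU' U'p sG Gg]]] := sX p Sp.
exists (U `&` U'), (fun q => \sum_i scale (dot (G q) (e i)) ('D_(e i) F q)).
have oUU' : open (U `&` U') by exact: openI.
split=> //.
  move=> k; apply: Ck_sum => // i.
  apply: (@Ck_bilin _ _ _ _ _ (@scale W) (@scale_bilin_continuous W) _ _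
    (fun q => dot (G q) (e i)) (fun q => 'D_(e i) F q)) => //.
    apply: (@Ck_bilin _ _ _ _ _ (@dot R : vec -> vec -> R^o) dot_continuous _ _
      G (fun=> e i)) => //.
      by apply: sub_Ck (sG k) => x [].
    exact: Ck_cst.
  by apply: sub_Ck ((sF k.+1).2 (e i)) => x [].
move=> x [Ux U'x] Sx; have dF := smooth_differentiable sF Ux.
rewrite (dS_ext oU Ux Sx (tX x Sx) Ff dF) (deriveE _ dF) -(Gg x U'x Sx).
rewrite {2}(std_frame_sum (G x)) linear_sum; apply: eq_bigr => i _.
by rewrite linearZ dot_std (deriveE _ dF).
Qed.

End SphereCalculus.

(** * The round structures *)

Section Structures.
Variable R : realType.
Local Notation vec := 'cV[R]_7.
Implicit Types (p q u v x m : vec) (X Y Z : vec -> vec).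

Lemma smoothS_id : smoothS (id : vec -> vec).
Proof. exact: (@smoothS_linear _ _ idfun). Qed.

Lemma dS_id p v : S6 p -> tangent p v -> dS id p v = v.
Proof. exact: (@dS_lin _ _ idfun). Qed.

Lemma smoothS_scale (W : normedModType R) (f : vec -> R^o) (h : vec -> W) :
  smoothS f -> smoothS h -> smoothS (fun x => f x *: h x).
Proof. exact: (@smoothS_bilin _ _ _ _ (@scale _ W) (@scale_bilin_continuous _ W)). Qed.

Lemma dS_scale (W : normedModType R) (f : vec -> R^o) (h : vec -> W) p v :
  smoothS f -> smoothS h -> S6 p -> tangent p v ->
  dS (fun x => f x *: h x) p v = dS f p v *: h p + f p *: dS h p v.
Proof. exact: (@dS_bilin _ _ _ _ (@scale _ W) (@scale_bilin_continuous _ W)). Qed.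

Lemma smoothS_dot X Y : smoothS X -> smoothS Y ->
  smoothS (fun q => dot (X q) (Y q) : R^o).
Proof. exact: (@smoothS_bilin _ _ _ _ (@dot R : vec -> vec -> R^o) (@dot_continuous R)). Qed.

Lemma dS_dot X Y p v : smoothS X -> smoothS Y -> S6 p -> tangent p v ->
  dS (fun q => dot (X q) (Y q) : R^o) p v = dot (dS X p v) (Y p) + dot (X p) (dS Y p v).
Proof. exact: (@dS_bilin _ _ _ _ (@dot R : vec -> vec -> R^o) (@dot_continuous R)). Qed.

Lemma smoothS_cross X Y : smoothS X -> smoothS Y -> smoothS (fun q => cross (X q) (Y q)).
Proof. exact: (@smoothS_bilin _ _ _ _ (@cross R) (@cross_continuous R)). Qed.

Lemma dS_cross X Y p v : smoothS X -> smoothS Y -> S6 p -> tangent p v ->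
  dS (fun q => cross (X q) (Y q)) p v = cross (dS X p v) (Y p) + cross (X p) (dS Y p v).
Proof. exact: (@dS_bilin _ _ _ _ (@cross R) (@cross_continuous R)). Qed.

Lemma dot_crossK p u v : S6 p -> tangent p u -> dot (cross p u) (cross p v) = dot u v.
Proof. by move=> Sp pu; rewrite dot_cross_cross Sp pu mul1r mul0r subr0. Qed.

Definition std_metric : metric_field R := fun _ => @dot R.
Definition std_complex : endo_field R := @cross R.

Lemma std_almost_hermitian : almost_hermitian std_metric std_complex.
Proof.
split.
- split=> [p a u v w _ _ _ _|p u v _ _ _|p u _ _ u0|X Y [_ sX] [_ sY]].
  + by rewrite /std_metric dotDl dotZl.
  + exact: dotC.
  + exact: dot_gt0.
  + exact: smoothS_dot.
- split=> [p u _ _|p a u v _ _ _|p u Sp pu|X [_ sX]].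
  + exact: dot_crossl.
  + by rewrite /std_complex crossDr crossZr.
  + exact: cross_unitK.
  + exact: smoothS_cross smoothS_id sX.
- by move=> p u v Sp pu _; exact: dot_crossK.
Qed.

Lemma std_invariant : invariant_structure std_metric std_complex.
Proof.
split; first exact: std_almost_hermitian.
by split=> [A p u v GA _ _ _|A p u GA _ _]; [exact: G2_dot|exact: G2_cross].
Qed.

Lemma isometry_tangent (f : {linear vec -> vec}) p u :
  (forall u v, dot (f u) (f v) = dot u v) -> tangent p u -> tangent (f p) (f u).
Proof. by move=> fd; rewrite /tangent fd. Qed.

Lemma linear_diffeo (f h : {linear vec -> vec}) :
  (forall u v, dot (f u) (f v) = dot u v) -> cancel f h -> cancel h f -> diffeo f h.
Proof.
move=> fd fK hK; split=> [p Sp|p Sp||| p _|p _]; rewrite /S6 /= ?fK ?hK //.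
- by rewrite fd.
- by rewrite -fd hK.
- exact: smoothS_linear.
- exact: smoothS_linear.
Qed.

(** The diffeomorphism is multiplication by t = s s', the identity or the antipodal map, which is
    its own inverse. Pulling back J' produces three factors t, from the point, the vector and the
    inverse map, and t^3 s' = s. *)
Lemma homothetic_std (c s c' s' : R) (g : metric_field R) (J : endo_field R)
    (g' : metric_field R) (J' : endo_field R) :
  0 < c -> 0 < c' -> s = 1 \/ s = -1 -> s' = 1 \/ s' = -1 ->
  (forall p u v, S6 p -> tangent p u -> tangent p v -> g p u v = c * dot u v) ->
  (forall p u v, S6 p -> tangent p u -> tangent p v -> g' p u v = c' * dot u v) ->
  (forall p u, S6 p -> tangent p u -> J p u = s *: cross p u) ->
  (forall p u, S6 p -> tangent p u -> J' p u = s' *: cross p u) ->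
  homothetic g J g' J'.
Proof.
move=> c0 c'0 s1 s'1 gE g'E JE J'E.
pose t := s * s'.
have tt : t * t = 1.
  by rewrite /t; case: s1 => ->; case: s'1 => ->;
    rewrite ?(mulrNN, mulr1, mul1r, mulrN, opprK, mulN1r).
pose f : {linear vec -> vec} := *:%R t.
have fd u v : dot (f u) (f v) = dot u v by rewrite /f /= dotZl dotZr mulrA tt mul1r.
have fK : cancel f f by move=> u; rewrite /f /= scalerA tt scale1r.
exists f, f, (c' / c); split.
- exact: linear_diffeo.
- exact: divr_gt0.
- move=> p u v Sp pu pv; rewrite /pullback_metric !dS_lin // g'E ?gE //.
  + by rewrite fd mulrA divfK // gt_eqF.
  + by rewrite /S6 /= fd.
  + exact: isometry_tangent.
  + exact: isometry_tangent.
- move=> p u Sp pu; have Sfp : S6 (f p) by rewrite /S6 /= fd.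
  have fpu : tangent (f p) (f u) by exact: isometry_tangent.
  rewrite /pullback_endo (dS_lin f Sp pu) J'E // dS_lin //; last first.
    by rewrite /tangent dotZr dot_crossl mulr0.
  rewrite JE // /f /= crossZl crossZr !scalerA; congr (_ *: _).
  transitivity (s * (s' * s') * (t * t)); first by rewrite /t; ring.
  by rewrite tt; case: s'1 => ->; rewrite ?mulrNN !mulr1.
Qed.

(** * The Levi-Civita connection and the nearly Kaehler identity *)

Section Round.
Variables (c s : R) (g : metric_field R) (J : endo_field R).
Hypothesis gE : forall p u v, S6 p -> tangent p u -> tangent p v ->
  g p u v = c * dot u v.
Hypothesis JE : forall p u, S6 p -> tangent p u -> J p u = s *: cross p u.

(* Orthogonal projection to the sphere of the flat connection of R^7. *)
Definition nabla X Y : vec -> vec := fun p => dS Y p (X p) + dot (X p) (Y p) *: p.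

(** Differentiate q . Y q = 0 along X. *)
Lemma dot_dS X Y p : vector_field X -> vector_field Y -> S6 p ->
  dot p (dS Y p (X p)) = - dot (X p) (Y p).
Proof.
move=> [tX sX] [tY sY] Sp; apply/eqP; rewrite -addr_eq0 addrC; apply/eqP.
rewrite -[X in dot X _ + _](dS_id Sp (tX p Sp)).
rewrite -(dS_dot smoothS_id sY Sp (tX p Sp)) -(dS_cst (0 : R^o) p (X p)).
by apply: eq_dS => // x Sx; exact: tY.
Qed.

Lemma nabla_field X Y : vector_field X -> vector_field Y -> vector_field (nabla X Y).
Proof.
move=> vX vY; have [tX sX] := vX; have [tY sY] := vY; split=> [p Sp|].
  by rewrite /tangent dotDr dotZr Sp mulr1 dot_dS // addNr.
apply: smoothSD; first exact: smoothS_dS.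
by apply: smoothS_scale smoothS_id; exact: smoothS_dot.
Qed.

Lemma dot_nabla X Y Z p : vector_field Z -> S6 p ->
  dot (nabla X Y p) (Z p) = dot (dS Y p (X p)) (Z p).
Proof.
by move=> [tZ _] Sp; rewrite dotDl dotZl tZ // mulr0 addr0.
Qed.

(** The normal correction is symmetric in X and Y, so it leaves the torsion of the flat connection
    unchanged, and it vanishes when paired with a tangent field, so metric compatibility is the
    Leibniz rule for [dot]. The factor c is constant and has zero differential. *)
Lemma nabla_levi_civita : levi_civita g nabla.
Proof.
split.
- exact: nabla_field.
- move=> f X X' Y p sf [tX sX] [tX' sX'] [tY sY] Sp.
  rewrite /nabla dS_linear //; [|exact: tX|exact: tX'].
  rewrite dotDl dotZl scalerDr scalerDl scalerA; exact: addrACA.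
- move=> X Y Y' p [tX sX] [tY sY] [tY' sY'] Sp.
  rewrite /nabla dSD //; last exact: tX.
  by rewrite dotDr scalerDl addrACA.
- move=> f X Y p sf [tX sX] [tY sY] Sp.
  rewrite /nabla dS_scale //; last exact: tX.
  by rewrite dotZr -addrA -scalerA -scalerDr.
- move=> X Y p [tX sX] [tY sY] Sp.
  by rewrite /nabla /lie_bracket (dotC (Y p)) opprD addrACA subrr addr0.
- move=> X Y Z p vX vY vZ Sp; have [tX sX] := vX; have [tY sY] := vY; have [tZ sZ] := vZ.
  have [tXY _] := nabla_field vX vY; have [tXZ _] := nabla_field vX vZ.
  rewrite !gE //; [|exact: tY|exact: tXZ|exact: tXY|exact: tZ].
  rewrite dot_nabla // (dotC (Y p)) dot_nabla // (dotC _ (Y p)) -mulrDr.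
  rewrite -(dS_dot sY sZ Sp (tX p Sp)).
  pose YZ : vec -> R^o := fun q => dot (Y q) (Z q).
  rewrite (@eq_dS _ R^o _ (fun q => (fun=> c : R^o) q *: YZ q)) //; last first.
    by move=> x Sx; rewrite gE; [|by []|exact: tY|exact: tZ].
  rewrite dS_scale //; [|exact: smoothS_cst|exact: smoothS_dot|exact: tX].
  by rewrite dS_cst scale0r add0r.
Qed.

(* (nabla_X J) Y = s (X x Y) up to a multiple of p, hence is skew in X and Y. *)
Lemma cov_deriv_J X Y p : vector_field X -> vector_field Y -> S6 p ->
  cov_deriv_endo nabla J X Y p =
  s *: (cross (X p) (Y p) + dot (X p) (cross p (Y p)) *: p).
Proof.
move=> vX vY Sp; have [tX sX] := vX; have [tY sY] := vY.
have [tXY _] := nabla_field vX vY.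
have sJ : smoothS (fun q => cross q (Y q)) by exact: smoothS_cross smoothS_id sY.
rewrite /cov_deriv_endo JE //; last exact: tXY.
rewrite {1}/nabla JE //; last exact: tY.
rewrite (@eq_dS _ _ _ (fun q => (fun=> s : R^o) q *: cross q (Y q))) //; last first.
  by move=> x Sx; rewrite JE //; exact: tY.
rewrite dS_scale //; [|exact: smoothS_cst|exact: tX].
rewrite dS_cst scale0r add0r (dS_cross smoothS_id sY Sp (tX p Sp)).
(* Multiplication by p kills the normal part of [nabla X Y]; what remains of the subtracted term
   cancels the derivative falling on Y. *)
rewrite (dS_id Sp (tX p Sp)) dotZr -scalerA /nabla crossDr crossZr crossvv scaler0 addr0.
by rewrite -scalerDr -scalerBr addrAC addrK.
Qed.

(** Both terms of [cov_deriv_J] change sign when X and Y are exchanged, the second because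
    [dot u (cross v w)] is alternating. *)
Lemma round_nearly_kahler : almost_hermitian g J -> nearly_kahler g J.
Proof.
move=> gJ; split=> //; exists nabla; split; first exact: nabla_levi_civita.
move=> X Y p vX vY Sp; rewrite !cov_deriv_J // -scalerN; congr (_ *: _).
rewrite opprD -crossC -scaleNr; congr (_ + _ *: _).
by rewrite dotC dot_cross crossC dotNr (dotC (Y p)) dot_cross -dotNr -crossC.
Qed.

End Round.

(** * Rotations of order three about an axis *)

Section Rotation.
Variables (k : R) (m : vec).

(** For a unit vector m the coefficient 3/2 makes m fixed, as 3/2 - 1/2 = 1. On the orthogonal
    complement the map is -1/2 + k i with i = [cross m], a rotation by a third of a turn when k^2 =
    3/4. *)
Definition rot u : vec := (3 / 2 * dot m u) *: m - 2^-1 *: u + k *: cross m u.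

Lemma rot_is_linear : linear rot.
Proof.
move=> a u v; rewrite /rot dotDr dotZr crossDr crossZr.
move: (cross m u) (cross m v) => y z.
by apply: col7P => i; rewrite !mxE; ring.
Qed.
HB.instance Definition _ := GRing.isLinear.Build R vec vec _ rot rot_is_linear.

End Rotation.

Lemma dot_rot k m u v : S6 m -> k ^+ 2 = 3 / 4 -> dot (rot k m u) (rot k m v) = dot u v.
Proof.
move=> Sm kk; rewrite /rot !(dotDl, dotDr, dotZl, dotZr, dotNl, dotNr).
have -> : dot (cross m u) (cross m v) = dot u v - dot m u * dot m v.
  by rewrite dot_cross_cross Sm mul1r.
have -> : dot u (cross m v) = - dot v (cross m u).
  by rewrite -dot_cross (crossC u) dotNl dotC.
rewrite !(dotC _ m) !dot_crossl Sm (dotC (cross m u) v).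
move: (dot v (cross m u)) (dot m u) (dot m v) (dot u v) => d a b w.
(* For [lra] monomials are atoms, so the relation k^2 = 3/4 is supplied already multiplied by the
   factor that occurs. *)
have : k * k * (w - a * b) = 3 / 4 * (w - a * b) by rewrite -expr2 kk.
lra.
Qed.

Lemma dot_center_rot k m u : S6 m -> dot m (rot k m u) = dot m u.
Proof.
move=> Sm; rewrite /rot !dotDr dotNr !dotZr Sm dot_crossl; lra.
Qed.

Lemma cross_center_rot k m u : S6 m ->
  cross m (rot k m u) = - 2^-1 *: cross m u + k *: (dot m u *: m - u).
Proof.
move=> Sm; rewrite /rot !crossDr crossNr !crossZr crossvv scaler0 add0r -scaleNr.
by rewrite cross_crossvv Sm scale1r.
Qed.

(** On the orthogonal complement of m this says that the square of a primitive cube root of unity is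
    its conjugate. *)
Lemma rot_rot k m u : S6 m -> k ^+ 2 = 3 / 4 -> rot k m (rot k m u) = rot (- k) m u.
Proof.
move=> Sm kk; rewrite {1}/rot dot_center_rot // cross_center_rot // /rot.
move: (cross m u) (dot m u) => y a; apply: col7P => i; rewrite !mxE.
move: (u i 0) (m i 0) (y i 0) => u' m' y'.
have : k * k * (a * m' - u') = 3 / 4 * (a * m' - u') by rewrite -expr2 kk.
lra.
Qed.

Lemma rotNK k m : S6 m -> k ^+ 2 = 3 / 4 -> cancel (rot (- k) m) (rot k m).
Proof.
move=> Sm kk u; rewrite {1}/rot dot_center_rot // cross_center_rot // /rot.
move: (cross m u) (dot m u) => y a; apply: col7P => i; rewrite !mxE.
move: (u i 0) (m i 0) (y i 0) => u' m' y'.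
have : k * k * (a * m' - u') = 3 / 4 * (a * m' - u') by rewrite -expr2 kk.
lra.
Qed.

Lemma rotK k m : S6 m -> k ^+ 2 = 3 / 4 -> cancel (rot k m) (rot (- k) m).
Proof.
by move=> Sm kk; have := @rotNK (- k) m Sm; rewrite opprK sqrrN; apply.
Qed.

Lemma rot_center k m : S6 m -> rot k m m = m.
Proof.
move=> Sm; rewrite /rot Sm crossvv scaler0 addr0 mulr1 -scalerBl.
by rewrite (_ : 3 / 2 - 2^-1 = 1) ?scale1r //; lra.
Qed.

(** Pairing the equation with the component w of x orthogonal to m gives - (w . w) / 2 = w . w,
    hence w = 0. *)
Lemma rot_fixed k m x : S6 m -> rot k m x = x -> x = dot m x *: m.
Proof.
move=> Sm fx; apply/subr0_eq/dot_eq0.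
pose w : vec := x - dot m x *: m; rewrite -/w.
have mw : dot m w = 0 by rewrite dotDr dotNr dotZr Sm mulr1 subrr.
have cw : dot (cross m x) w = 0.
  by rewrite dotDr dotNr dotZr !(dotC (cross m x)) dot_crossl dot_crossr mulr0 subr0.
have xw : dot x w = dot w w by rewrite {2}/w dotDl dotNl dotZl mw mulr0 subr0.
clearbody w; have := congr1 (fun y : vec => dot y w) fx.
rewrite /= /rot !dotDl dotNl !dotZl mw cw xw; lra.
Qed.

Lemma round_three_symmetric (c s : R) (g : metric_field R) (J : endo_field R) :
  s = 1 \/ s = -1 ->
  (forall p u v, S6 p -> tangent p u -> tangent p v -> g p u v = c * dot u v) ->
  (forall p u, S6 p -> tangent p u -> J p u = s *: cross p u) ->
  riemannian g -> three_symmetric g J.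
Proof.
move=> s1 gE JE gR; split=> //.
(* The sign s turns the rotation in the direction of J, which is s times [cross m]. *)
pose k := s * (Num.sqrt 3 / 2).
have kk : k ^+ 2 = 3 / 4.
  have s2 : s ^+ 2 = 1 by case: s1 => ->; rewrite ?sqrrN expr1n.
  rewrite /k exprMn s2 mul1r expr_div_n sqr_sqrtr ?ler0n //; congr (_ / _); ring.
exists (rot k) => m Sm; split.
- split.
    exists (rot (- k) m).
    by apply: linear_diffeo; [move=> u v; exact: dot_rot|exact: rotK|exact: rotNK].
  move=> p u v Sp pu pv; rewrite /pullback_metric !(@dS_lin _ _ (rot k m)) //.
  have T w : tangent p w -> tangent (rot k m p) (rot k m w) by rewrite /tangent dot_rot.
  rewrite !gE ?dot_rot //; [by rewrite /S6 /= dot_rot|exact: T|exact: T].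
- by move=> x _; rewrite rot_rot // rotK.
- split; first exact: rot_center.
  (* The fixed points on the sphere are m and -m; this open half-space contains only the first. *)
  exists [set x | 0 < dot m x]; split.
  + have -> : [set x | 0 < dot m x] = (fun x => dot m x : R^o) @^-1` [set r | 0 < r] by [].
    apply: open_comp; last exact: open_gt.
    move=> x _; apply: differentiable_continuous.
    exact: (differentiable_bilin_comp (@dot_continuous R)).
  + by rewrite /= Sm ltr01.
  + move=> x /= mx0 Sx /(rot_fixed Sm) xE.
    have /eqP : dot m x ^+ 2 = 1.
      by move: Sx; rewrite /S6 /= {1 2}xE dotZl dotZr Sm mulr1 expr2.
    rewrite sqrf_eq1 => /orP[] /eqP mx1; first by rewrite xE mx1 scale1r.
    by move: mx0; rewrite mx1 oppr_gt0 ltNge ler01.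
- move=> v mv; have -> : dS (rot k m) m v = rot k m v.
    exact: (@dS_lin _ _ (rot k m)).
  have mv0 : dot m v = 0 by [].
  by rewrite /rot mv0 mulr0 scale0r add0r JE // scalerA scaleNr [_ * s]mulrC.
Qed.

End Structures.

Theorem proposition7p1 (R : realType) :
  S6_is_G2_mod_SU3 R /\
  (exists (g : metric_field R) (J : endo_field R), invariant_structure g J) /\
  (forall (g : metric_field R) (J : endo_field R)
          (g' : metric_field R) (J' : endo_field R),
     invariant_structure g J -> invariant_structure g' J' ->
     homothetic g J g' J') /\
  (forall (g : metric_field R) (J : endo_field R),
     invariant_structure g J -> nearly_kahler g J /\ three_symmetric g J).
Proof.
(* Uniqueness and both geometric properties are read off this normal form. *)
have round (g : metric_field R) (J : endo_field R) : invariant_structure g J ->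
    exists c s : R, [/\ 0 < c, s = 1 \/ s = -1,
    forall p u v, S6 p -> tangent p u -> tangent p v -> g p u v = c * dot u v &
    forall p u, S6 p -> tangent p u -> J p u = s *: cross p u].
  move=> [[gR JC _] gJ].
  have [c c0 gE] := G2_invariant_metric gR gJ.
  by have [s s1 JE] := G2_invariant_complex JC gJ; exists c, s.
split; first exact: S6_homogeneous.
split; first by exists (@std_metric R), (@std_complex R); exact: std_invariant.
split=> [g J g' J' /round[c [s [c0 s1 gE JE]]] /round[c' [s' [c'0 s'1 g'E J'E]]]|g J gJ].
  exact: homothetic_std gE g'E JE J'E.
have [c [s [c0 s1 gE JE]]] := round _ _ gJ; have [aH _] := gJ; have [gR _ _] := aH.
split; first exact: round_nearly_kahler gE JE aH.
exact: round_three_symmetric gE JE gR.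
Qed.
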